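(* Fix $q\in(2,4]$. Let $\mathcal{K}$ be a tame knot class such that $\mathscr{C}(\mathcal{K})$ contains a $D_2$-symmetric curve. Let $\vartheta_j\to0$ and, for each $j$, let $\Gamma_{\vartheta_j}\in\mathscr{C}(\mathcal{K})$ be an arclength parametrized $D_2$-symmetric curve with $E_{\vartheta_j}(\Gamma_{\vartheta_j})\le E_{\vartheta_j}(\beta)$ for all $D_2$-symmetric $\beta\in\mathscr{C}(\mathcal{K})$. Then there exist an arclength parametrized $D_2$-symmetric curve $\Gamma_0\in W^{2,2}(\mathbb{R}/\mathbb{Z},\mathbb{R}^3)$ and a subsequence $(\Gamma_{\vartheta_{j_k}})_k$ converging weakly in $W^{2,2}$ and strongly in $C^1$ to $\Gamma_0$ as $k\to\infty$. Moreover, $E(\Gamma_0)\le E(\beta)$ for all $D_2$-symmetric $\beta\in\mathscr{C}(\mathcal{K})$.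
   Context: $\mathscr{L}$ is length; $E(\gamma)=\int_\gamma\kappa^2ds$; for $q\in(2,4]$, $\mathrm{TP}_q(\gamma)=\iint_{(\mathbb{R}/\mathbb{Z})^2} r_{tp}(\gamma(s),\gamma(t))^{-q}|\gamma'(s)||\gamma'(t)|\,ds\,dt$ with $r_{tp}(\gamma(s),\gamma(t))$ the radius of the circle through $\gamma(s),\gamma(t)$ tangent to $\gamma$ at $\gamma(s)$; $E_\vartheta=E+\vartheta\mathrm{TP}_q^{1/(q-2)}$. $\mathscr{C}(\mathcal{K})=\{\gamma\in W^{2,2}(\mathbb{R}/\mathbb{Z},\mathbb{R}^3):\mathscr{L}(\gamma)=1,|\gamma'|>0,\ \gamma\text{ embedded of knot type }\mathcal{K}\}$. A tame knot class is one containing a polygonal representative. (Such symmetric minimizers $\Gamma_\vartheta$ exist for every $\vartheta>0$ under the hypothesis.) $D_2$-symmetry: $R_1=\mathrm{diag}(1,-1,-1)$, $R_2=\mathrm{diag}(-1,1,-1)$, $R_3=\mathrm{diag}(-1,-1,1)$; on $\mathbb{R}/\mathbb{Z}$: $\psi_1(t)=-t+1/2$, $\psi_2(t)=t-1/2$, $\psi_3(t)=-t$. A curve $\gamma\in C^0(\mathbb{R}/\mathbb{Z},\mathbb{R}^3)$ of finite positive length is $D_2$-symmetric if $R_i\gamma(\psi_i(t))=\gamma(t)$ for all $t\in\mathbb{R}/\mathbb{Z}$, $i=1,2,3$. *)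

(* Defs.v *)
From HB Require Import structures.
From Stdlib Require Import ClassicalEpsilon.
From mathcomp Require Import all_boot all_order all_algebra.
From mathcomp Require Import all_classical all_reals all_analysis.
Set Implicit Arguments. Unset Strict Implicit. Unset Printing Implicit Defensive.
Import Order.TTheory GRing.Theory Num.Theory.
Import numFieldNormedType.Exports.
Local Open Scope classical_set_scope.
Local Open Scope ring_scope.

Section Knots.
Variable R : realType.

Definition V3 := 'rV[R]_3.

Definition comp (u : V3) (k : nat) : R := u 0 (inord k).

Definition dot3 (u v : V3) : R := \sum_(i < 3) u 0 i * v 0 i.
Definition enorm (u : V3) : R := Num.sqrt (dot3 u u).
Definition cross (u v : V3) : V3 :=
  \row_(i < 3) (comp u ((i + 1) %% 3) * comp v ((i + 2) %% 3)
              - comp u ((i + 2) %% 3) * comp v ((i + 1) %% 3)).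

Definition leb := (@lebesgue_measure R).
Definition I01 : set R := `[0%R, 1%R]%classic.

Definition vint (a b : R) (g : R -> V3) : V3 :=
  \row_(i < 3) Rintegral leb `[a, b]%classic (fun x => g x 0 i).

Definition periodic1 (f : R -> V3) := forall t, f (t + 1) = f t.

(* g is a weak second derivative of gamma on R/Z: gamma' is the integral of g,
   and g is square integrable on [0,1]. *)
Definition is_wdd (gamma g : R -> V3) : Prop :=
  periodic1 g /\
  (forall i : 'I_3, measurable_fun I01 (fun x => g x 0 i)) /\
  (\int[leb]_(x in I01) ((enorm (g x)) ^+ 2)%:E < +oo)%E /\
  (forall s t, s <= t -> derive1 gamma t - derive1 gamma s = vint s t g).

(* W^{2,2}(R/Z, R^3), represented by its C^1 representative on R (1-periodic). *)
Definition W22 (gamma : R -> V3) : Prop :=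
  periodic1 gamma /\ (forall t, derivable gamma t 1) /\ exists g, is_wdd gamma g.

(* A chosen weak second derivative (unique a.e.). *)
Definition d2 (gamma : R -> V3) : R -> V3 :=
  epsilon (inhabits (fun _ => 0)) (fun g => is_wdd gamma g).

Definition curve_length (gamma : R -> V3) : R :=
  Rintegral leb I01 (fun t => enorm (derive1 gamma t)).

Definition arclength (gamma : R -> V3) : Prop :=
  forall t, enorm (derive1 gamma t) = 1.

Definition kappa (gamma : R -> V3) (t : R) : R :=
  enorm (cross (derive1 gamma t) (d2 gamma t)) / (enorm (derive1 gamma t)) ^+ 3.

Definition bending (gamma : R -> V3) : \bar R :=
  (\int[leb]_(t in I01) ((kappa gamma t) ^+ 2 * enorm (derive1 gamma t))%:E)%E.

(* 1 / r_tp(gamma(s), gamma(t)): inverse radius of the circle through gamma(s),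
   gamma(t) tangent to gamma at gamma(s);  0 (infinite radius) when the points
   are collinear with the tangent, and 0 by convention when gamma(s) = gamma(t). *)
Definition inv_rtp (gamma : R -> V3) (s t : R) : R :=
  let d := gamma t - gamma s in
  if d == 0 then 0 else
  2 * enorm (cross (derive1 gamma s) d) /
    (enorm (derive1 gamma s) * (enorm d) ^+ 2).

Definition TP (q : R) (gamma : R -> V3) : \bar R :=
  (\int[leb]_(s in I01) \int[leb]_(t in I01)
     (powR (inv_rtp gamma s t) q * enorm (derive1 gamma s)
        * enorm (derive1 gamma t))%:E)%E.

Definition Etheta (q theta : R) (gamma : R -> V3) : \bar R :=
  (bending gamma + theta%:E * poweR (TP q gamma) (1 / (q - 2)))%E.

Definition injective_mod1 (gamma : R -> V3) :=
  forall s t, s \in I01 -> t \in I01 -> s < t -> gamma s = gamma t -> s = 0 /\ t = 1.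

Definition is_knot (K : set V3) : Prop :=
  exists gamma : R -> V3,
    continuous gamma /\ periodic1 gamma /\ injective_mod1 gamma /\ K = range gamma.

Definition ambient_isotopic (K1 K2 : set V3) : Prop :=
  exists H : R -> V3 -> V3,
    {within [set p : R * V3 | 0 <= p.1 <= 1], continuous (fun p => H p.1 p.2)} /\
    (forall x, H 0 x = x) /\
    (forall t, 0 <= t <= 1 ->
       exists Hi : V3 -> V3, continuous (H t) /\ continuous Hi /\
         cancel (H t) Hi /\ cancel Hi (H t)) /\
    H 1 @` K1 = K2.

Definition is_knot_class (KK : set (set V3)) : Prop :=
  exists K0, is_knot K0 /\ KK = [set K | is_knot K /\ ambient_isotopic K0 K].

Definition segment (a b : V3) : set V3 :=
  [set (1 - l) *: a + l *: b | l in I01].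

Definition is_polygonal_knot (K : set V3) : Prop :=
  is_knot K /\ exists ps : seq V3,
    K = \bigcup_(i in [set i : nat | (i < size ps)%N])
          segment (nth 0 ps i) (nth 0 ps ((i + 1) %% size ps)).

Definition tame (KK : set (set V3)) : Prop :=
  is_knot_class KK /\ exists P, KK P /\ is_polygonal_knot P.

Definition CK (KK : set (set V3)) (gamma : R -> V3) : Prop :=
  W22 gamma /\ curve_length gamma = 1 /\
  (forall t, 0 < enorm (derive1 gamma t)) /\
  injective_mod1 gamma /\ KK (range gamma).

Definition diag3 (a b c : R) (v : V3) : V3 :=
  \row_(i < 3) ([:: a; b; c]`_i * v 0 i).

Definition D2sym (gamma : R -> V3) : Prop :=
  continuous gamma /\ periodic1 gamma /\ 0 < curve_length gamma /\
  (forall t, diag3 1 (-1) (-1) (gamma (- t + 1/2)) = gamma t) /\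
  (forall t, diag3 (-1) 1 (-1) (gamma (t - 1/2)) = gamma t) /\
  (forall t, diag3 (-1) (-1) 1 (gamma (- t)) = gamma t).

Definition ip22 (u v : R -> V3) : R :=
  Rintegral leb I01 (fun t => dot3 (u t) (v t) + dot3 (derive1 u t) (derive1 v t)
                              + dot3 (d2 u t) (d2 v t)).

(* weak convergence in the Hilbert space W^{2,2} (via Riesz representation) *)
Definition weak_W22_cvg (G : nat -> R -> V3) (G0 : R -> V3) : Prop :=
  forall phi, W22 phi -> (fun k => ip22 (G k) phi) @ \oo --> ip22 G0 phi.

Definition C1_cvg (G : nat -> R -> V3) (G0 : R -> V3) : Prop :=
  forall eps : R, 0 < eps -> \forall k \near \oo, forall t,
    enorm (G k t - G0 t) < eps /\ enorm (derive1 (G k) t - derive1 G0 t) < eps.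

End Knots.

(* Main.v *)
Require Import Defs.
From HB Require Import structures.
From mathcomp Require Import all_boot all_order all_algebra.
From mathcomp Require Import all_classical all_reals all_analysis.
From mathcomp Require Import measurable_realfun.
From mathcomp Require Import ring lra.
Import Order.TTheory GRing.Theory Num.Theory.
Import numFieldNormedType.Exports.
Local Open Scope classical_set_scope.
Local Open Scope ring_scope.
Set Implicit Arguments. Unset Strict Implicit. Unset Printing Implicit Defensive.

(** For an arclength parametrized curve the bending energy is the squared L^2 norm
    of the weak second derivative, since gamma'' is a.e. orthogonal to gamma'.
    Comparison with the fixed competitor Gamma 0 bounds the bending energies of all
    minimizers, so their tangents are uniformly 1/2-Hölder; the D2 symmetry puts
    gamma(0) and gamma(1/4) on coordinate axes, which bounds the curves themselves.
    Pointwise limits along an ultrafilter then give Gamma0, and a subsequence that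
    is close to it on finer and finer dyadic grids converges in C^1.  The weak second
    derivative of Gamma0 is the Radon-Nikodym density of the charge
    A |-> lim \int_A Gamma_j''.

    The difference quotient energies E_h(T) = \int |(T(s+h) - T(s)) / h|^2 ds are
    continuous for uniform convergence, bounded by \int |T'|^2, and converge to it as
    h -> 0 (Fatou and Lebesgue differentiation).  This yields at once the lower
    semicontinuity of the bending energy and, by polarization, weak convergence.

    To discard the term theta_j TP_q(beta)^(1/(q-2)) in the limit one needs
    TP_q(beta) < oo for every embedded regular W^{2,2} curve, a critical embedding
    for q = 4.  Up to a bi-Lipschitz constant, 1/r_tp(s, s+h) is at most the mean of
    f = |beta''| over [s, s+h], and the dyadic sum of 8^n \int (\int_s^{s+2^-n} f)^4 ds
    is bounded by a telescoping potential (a Bellman function argument). *)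

(** At exponent 4 the obvious estimate just misses. Cauchy-Schwarz on windows of length 2^-n bounds
    the n-th term of the dyadic sum by 2^n \int (\int_s^{s+2^-n} f^2)^2 ds, which is bounded in n
    but has no decay; for q < 4 there would be a factor 2^(n (q/2 - 2)). The potential gains
    summability by comparing consecutive scales: the square of a sum exceeds the sum of the squares
    by twice the product.

    For weak convergence, \int |T'|^2 - E_h(T) is a nonnegative quadratic form in T. Tested against
    S, Cauchy-Schwarz for this form costs the gap \int |S'|^2 - E_h(S), which is small for small h
    and independent of the sequence. The remaining pairing, that of E_h, sees only values of the
    functions, so at fixed h it tends to 0 under uniform convergence.

    The ultrafilter gives limits at all parameters and on all measurable sets at once, with no
    countable reduction. It yields no subsequence, which is why the dyadic grids enter. *)

Section IntervalIntegral.
Context {R : realType}.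
Notation mu := (@lebesgue_measure R).
Notation mR := (measurableTypeR R).
Implicit Types (a b c d : R) (f g : R -> R).

(** * Integrals over intervals, translations and periodic functions *)

Definition mf (D : set R) f := measurable_fun (D : set mR) (f : mR -> R).

Definition ri a b f : R := Rintegral mu `[a, b]%classic f.

Lemma riE a b f : ri a b f = Rintegral mu `[a, b]%classic f.
Proof. by []. Qed.

Definition itg a b f := mu.-integrable `[a, b]%classic (EFin \o f).

Lemma itgS a b c d f : c <= a -> b <= d -> itg c d f -> itg a b f.
Proof.
move=> ca bd; apply: integrableS => //.
by apply: subset_itv; rewrite bnd_simp.
Qed.

Lemma itgD a b f g : itg a b f -> itg a b g -> itg a b (fun x => f x + g x).
Proof. by move=> hf hg; apply: eq_integrable (integrableD _ hf hg). Qed.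

Lemma itgZ a b k f : itg a b f -> itg a b (fun x => k * f x).
Proof. by move=> hf; apply: eq_integrable (integrableZl _ k hf). Qed.

Lemma itgB a b f g : itg a b f -> itg a b g -> itg a b (fun x => f x - g x).
Proof. by move=> hf hg; apply: eq_integrable (integrableB _ hf hg). Qed.

Lemma itg_norm a b f : itg a b f -> itg a b (fun x => `|f x|).
Proof. by move=> hf; have := integrable_norm hf. Qed.

Lemma itg_cont a b f : continuous f -> itg a b f.
Proof.
move=> cf; apply: continuous_compact_integrable; first exact: segment_compact.
exact: continuous_subspaceT.
Qed.

Lemma itg_meas a b f : itg a b f -> mf `[a, b]%classic f.
Proof. by move=> /measurable_int /measurable_EFinP. Qed.

Lemma itg_le a b f g : mf `[a, b]%classic f ->
  (forall x, a <= x <= b -> `|f x| <= g x) -> itg a b g -> itg a b f.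
Proof.
move=> hm fg hg; apply: (le_integrable _ _ _ hg) => //.
  exact/measurable_EFinP.
move=> x; rewrite /= in_itv/= => /fg h.
by rewrite lee_fin (le_trans h)// ler_norm.
Qed.

Lemma riD a b f g : itg a b f -> itg a b g ->
  ri a b (fun x => f x + g x) = ri a b f + ri a b g.
Proof. by move=> ? ?; rewrite /ri RintegralD. Qed.

Lemma riB a b f g : itg a b f -> itg a b g ->
  ri a b (fun x => f x - g x) = ri a b f - ri a b g.
Proof. by move=> ? ?; rewrite /ri RintegralB. Qed.

Lemma riZ a b k f : itg a b f -> ri a b (fun x => k * f x) = k * ri a b f.
Proof. by move=> ?; rewrite /ri RintegralZl. Qed.

Lemma ri_le a b f g : itg a b f -> itg a b g ->
  (forall x, a <= x <= b -> f x <= g x) -> ri a b f <= ri a b g.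
Proof.
by move=> hf hg fg; apply: le_Rintegral => // x; rewrite /= in_itv/=; exact: fg.
Qed.

Lemma ri_ge0 a b f : (forall x, a <= x <= b -> 0 <= f x) -> 0 <= ri a b f.
Proof. by move=> h; apply: Rintegral_ge0 => x; rewrite /= in_itv/=; exact: h. Qed.

Lemma eq_ri a b f g : (forall x, a <= x <= b -> f x = g x) ->
  ri a b f = ri a b g.
Proof.
by move=> h; apply: eq_Rintegral => x; rewrite inE/= in_itv/=; exact: h.
Qed.

Lemma ri_cst a b k : a <= b -> ri a b (fun=> k) = k * (b - a).
Proof.
move=> ab; rewrite /ri Rintegral_cst//= lebesgue_measure_itv/= lte_fin.
move: ab; rewrite le_eqVlt => /orP[/eqP->|->//].
by rewrite ltxx subrr.
Qed.

Lemma ri_norm a b f : itg a b f -> `|ri a b f| <= ri a b (fun x => `|f x|).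
Proof. by move=> hf; exact: le_normr_Rintegral. Qed.

Lemma ri_cat a b c f : a <= b -> b <= c -> itg a c f ->
  ri a c f = ri a b f + ri b c f.
Proof.
move=> ab bc hf.
have := @Rintegral_itvB R f (BLeft a) (BRight c) b hf.
rewrite !bnd_simp => /(_ ab bc) h.
have bcf : itg b c f by apply: itgS hf.
apply/eqP; rewrite -subr_eq0 opprD addrA subr_eq0; apply/eqP.
rewrite [LHS]h Rintegral_itv_obnd_cbnd//.
by apply: integrableS bcf => //; apply: subset_itv; rewrite bnd_simp.
Qed.

Lemma ri_aa a f : ri a a f = 0.
Proof. by rewrite /ri set_itv1 Rintegral_set1. Qed.

Lemma itgE a b f : itg a b f ->
  (ri a b f)%:E = (\int[mu]_(x in `[a, b]) (f x)%:E)%E.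
Proof. by move=> hf; rewrite /ri /Rintegral fineK//; exact: integrable_fin_num. Qed.

(** Measurability on the whole line is recorded apart from integrability because translations are
    handled by pushing Lebesgue measure forward, which involves functions on all of R. *)
Definition loc f := mf setT f /\ forall a b, itg a b f.

Lemma measurable_shift c : measurable_fun setT ((fun x => x + c) : mR -> mR).
Proof.
apply: continuous_measurable_fun => x.
by apply: cvgD; [exact: cvg_id|exact: cvg_cst].
Qed.

Lemma shift_preimage a b c :
  ((fun x : R => x + c) @^-1` `[a + c, b + c]%classic) = `[a, b]%classic.
Proof. by apply/seteqP; split => x; rewrite /= !in_itv/= !lerD2r. Qed.

(** Lebesgue measure is determined by its values on half-open intervals, and these do not change
    under translation. *)
Lemma lebesgue_measure_shift c (A : set R) : measurable A ->
  pushforward mu ((fun x => x + c) : _ -> measurableTypeR R) A = mu A.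
Proof.
move=> mA.
pose phi : {mfun measurableTypeR R >-> measurableTypeR R} :=
  HB.pack ((fun x => x + c) : measurableTypeR R -> measurableTypeR R)
   (isMeasurableFun.Build _ _ _ _ _ (measurable_shift c)).
apply/esym/(@lebesgue_measure_unique R (pushforward mu phi)) => //= _ [[a b]] _ <-.
rewrite /pushforward.
have -> : ((fun x : R => x + c) @^-1` `]a, b]%classic) = `]a - c, b - c]%classic.
  by apply/seteqP; split => x; rewrite /= !in_itv/= ltrBlDr lerBrDr.
rewrite !lebesgue_measure_itv/= !lte_fin ltrD2r; case: ifP => // _.
by congr (_%:E); ring.
Qed.

Lemma ge0_integral_shift a b c (f : mR -> \bar R) :
  measurable_fun setT f -> (forall x, 0 <= f x)%E ->
  (\int[mu]_(x in `[(a + c)%R, (b + c)%R]) f x =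
   \int[mu]_(x in `[a, b]) f (x + c)%R)%E.
Proof.
move=> hm f0; rewrite -(shift_preimage a b c).
have := @ge0_integral_pushforward _ _ _ _ R _ (measurable_shift c) mu
  `[a + c, b + c]%classic f (measurable_itv _) (measurable_funTS hm)
  (fun x _ => f0 x).
move=> /= <-; apply: eq_measure_integral => [|mc A mA _].
  exact: measurable_shift.
exact/esym/lebesgue_measure_shift.
Qed.

Lemma loc_shift c f : loc f -> loc (fun x => f (x + c)).
Proof.
move=> [hm lf]; have mfc : mf setT (fun x => f (x + c)).
  by apply: (measurableT_comp hm); exact: measurable_shift.
split=> // a b; apply/integrableP; split.
  by apply/measurable_EFinP; exact: measurable_funTS.
have /integrableP[_] := lf (a + c) (b + c).
rewrite (@ge0_integral_shift a b c (fun x => (`|(f x)%:E|)%E))//.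
by do 2 apply: measurableT_comp => //.
Qed.

Lemma ri_shift a b c f : loc f ->
  ri (a + c) (b + c) f = ri a b (fun x => f (x + c)).
Proof.
move=> lf; have [hm _] := lf; rewrite /ri /Rintegral; congr fine.
have lc := loc_shift c lf.
have hme : measurable_fun setT (EFin \o (f : mR -> R)) by exact/measurable_EFinP.
have h : mu.-integrable ((fun x : R => x + c) @^-1` `[a + c, b + c]%classic)
   ((EFin \o f) \o (fun x => x + c)).
  by rewrite shift_preimage; exact: lc.2.
have := @integral_pushforward _ _ _ _ R _ (measurable_shift c) mu _ _
   hme h (measurable_itv _).
rewrite shift_preimage => /= <-.
apply: eq_measure_integral => [|mc A mA _].
  exact: measurable_shift.
exact/esym/lebesgue_measure_shift.
Qed.

Lemma loc_cont f : continuous f -> loc f.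
Proof.
by move=> cf; split; [exact: continuous_measurable_fun|move=> a b; exact: itg_cont].
Qed.

Lemma locD f g : loc f -> loc g -> loc (fun x => f x + g x).
Proof.
move=> [hm lf] [hm' lg]; split; first exact: measurable_funD.
by move=> a b; exact: itgD.
Qed.

Lemma locZ k f : loc f -> loc (fun x => k * f x).
Proof.
move=> [hm lf]; split; first exact: measurable_funM.
by move=> a b; exact: itgZ.
Qed.

Lemma loc_norm f : loc f -> loc (fun x => `|f x|).
Proof.
move=> [hm lf]; split; first exact: measurableT_comp.
by move=> a b; exact: itg_norm.
Qed.

Definition per f := forall x, f (x + 1) = f x.

Lemma perN f x (n : nat) : per f -> f (x + n%:R) = f x.
Proof.
by move=> pf; elim: n => [|n IH]; rewrite ?addr0// -natr1 addrA pf.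
Qed.

Lemma per_int f x (n : int) : per f -> f (x + n%:~R) = f x.
Proof.
move=> pf; case: n => n; first exact: perN.
by rewrite NegzE mulrNz -[in RHS](subrK n.+1%:R x) perN.
Qed.

(** [-n, n] is a finite union of unit intervals with integer endpoints, on each of which f is a
    translate of its restriction to [0, 1]. *)
Lemma per_meas f : per f -> mf `[0, 1]%classic f -> mf setT f.
Proof.
move=> pf hm.
have -> : [set: R] = \bigcup_(n : nat) `[- n%:R, n%:R]%classic.
  apply/esym/seteqP; split=> // x _.
  exists (Num.trunc `|x|).+1 => //=; rewrite in_itv/= -ler_norml ltW//.
  exact: truncnS_gt.
apply/measurable_fun_bigcup => // n; move: n.
have key (m : int) : mf `[m%:~R, m%:~R + 1]%classic f.
  have -> : f = (f \o (fun x => x + (- m)%:~R)).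
    by apply/funext => x /=; rewrite per_int.
  apply: (measurable_comp (measurable_itv `[0, 1])).
  - move=> _ [x + <-] /=; rewrite !in_itv/= rmorphN/= => /andP[? ?].
    by rewrite subr_ge0 lerBlDl; apply/andP.
  - exact: hm.
  - exact: (measurable_funS measurableT (@subsetT _ _) (measurable_shift _)).
have step (k : nat) (m : int) : mf `[m%:~R, m%:~R + k%:R]%classic f.
  elim: k => [|k IH].
    by rewrite addr0 set_itv1; exact: measurable_fun_set1.
  have -> : `[m%:~R, m%:~R + k.+1%:R]%classic =
    `[m%:~R, m%:~R + k%:R]%classic `|`
    `[(m + k)%:~R, (m + k)%:~R + 1]%classic :> set R.
    rewrite rmorphD/= -natr1; apply/seteqP; split=> x /=; rewrite !in_itv/=.
      case/andP=> h1 h2; have [h|h] := leP x (m%:~R + k%:R); first by left; rewrite h1.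
      by right; rewrite -addrA h2 andbT; apply: ltW.
    have k0 : 0 <= k%:R :> R by [].
    by rewrite -!pmulrn; case=> /andP[h1 h2]; apply/andP; split; lra.
  by apply/measurable_funU => //; split=> //; exact: key.
move=> n; have := step (n + n)%N (- (n%:Z)).
rewrite rmorphN/= natrD addrA; set z := (- _ + _).
by have -> : z = 0 by [rewrite /z -pmulrn addNr]; rewrite add0r.
Qed.

Lemma loc_per f : per f -> itg 0 1 f -> loc f.
Proof.
move=> pf hf; have hm := per_meas pf (itg_meas hf); split=> // a b.
have hef : measurable_fun setT (fun x : mR => (`|(f x)%:E|)%E).
  by do 2 apply: measurableT_comp => //.
have key (m : int) : itg m%:~R (m%:~R + 1) f.
  apply/integrableP; split; first by apply/measurable_EFinP; exact: measurable_funTS.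
  have := @ge0_integral_shift 0 1 m%:~R (fun x => (`|(f x)%:E|)%E) hef.
  rewrite add0r addrC => -> //.
  under eq_integral do rewrite per_int//.
  by case/integrableP: hf.
have step (k : nat) (m : int) : itg m%:~R (m%:~R + k%:R) f.
  elim: k => [|k IH].
    apply/integrableP; split; first by apply/measurable_EFinP; exact: measurable_funTS.
    by rewrite addr0 set_itv1 integral_set1.
  have -> : m%:~R + k.+1%:R = (m + k)%:~R + 1 :> R.
    by rewrite rmorphD/= -natr1 -pmulrn addrA.
  apply/integrableP; split; first by apply/measurable_EFinP; exact: measurable_funTS.
  apply: (@le_lt_trans _ _ (\int[mu]_(x in `[m%:~R, (m%:~R + k%:R)%R] `|`
    `[(m + k)%:~R, ((m + k)%:~R + 1)%R]) `|(f x)%:E|)%E).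
    apply: ge0_subset_integral => //; first exact: measurableU.
      exact: measurable_funTS.
    rewrite rmorphD/= -pmulrn => x /=; rewrite !in_itv/=.
    case/andP=> h1 h2; have [h|h] := leP x (m%:~R + k%:R); first by left; rewrite h1.
    by right; rewrite h2 andbT; apply: ltW.
  apply: (@le_lt_trans _ _ (\int[mu]_(x in `[m%:~R, (m%:~R + k%:R)%R]) `|(f x)%:E|
    + \int[mu]_(x in `[(m + k)%:~R, ((m + k)%:~R + 1)%R]) `|(f x)%:E|)%E).
    (* Consecutive unit intervals share an endpoint, so the second is replaced by its difference
       with the first before additivity is used. *)
    have -> : `[m%:~R, m%:~R + k%:R]%classic `|` `[(m + k)%:~R, (m + k)%:~R + 1]%classic
      = `[m%:~R, m%:~R + k%:R]%classic `|` (`[(m + k)%:~R, (m + k)%:~R + 1]%classic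
        `\` `[m%:~R, m%:~R + k%:R]%classic) :> set R by rewrite setUDr setDv setD0.
    rewrite ge0_integral_setU//=; last 3 first.
    + exact: measurableD.
    + exact: measurable_funTS.
    + by apply/disj_setPS => x [? []].
    rewrite leeD2l//; apply: ge0_subset_integral => //; first exact: measurableD.
    exact: measurable_funTS.
  by rewrite lte_add_pinfty//; [case/integrableP: IH|case/integrableP: (key (m + k))].
pose n := (Num.trunc (Num.max `|a| `|b|)).+1.
apply: (@itgS a b (- n%:~R) (- n%:~R + (n + n)%:R)); last first.
  by have := step (n + n)%N (- n%:Z); rewrite rmorphN.
all: have := @truncnS_gt R (Num.max `|a| `|b|); rewrite gt_max -/n => /andP[/ltW+ /ltW].
- by rewrite !ler_norml natrD addrA -pmulrn addNr add0r => _ /andP[].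
- by rewrite ler_norml -pmulrn => /andP[].
Qed.

End IntervalIntegral.

(* Otherwise [ring] and [lra] unfold integrals when comparing atoms. *)
Opaque ri.

(** * Absolutely continuous functions and their difference quotient energies *)

Section Primitive.
Context {R : realType}.
Notation mu := (@lebesgue_measure R).
Notation mR := (measurableTypeR R).
Implicit Types (a b c h s t x : R) (f g T : R -> R).

(** Once the integer part of a is removed, the piece of [r, r + 1] beyond 1 is the translate of
    [0, r]. *)
Lemma ri_per a f : loc f -> per f -> ri a (a + 1) f = ri 0 1 f.
Proof.
move=> lf pf; have hf := lf.2.
pose m := Num.floor a; pose r := a - m%:~R.
have r0 : 0 <= r by rewrite subr_ge0 floor_le.
have r1 : r <= 1.
  by rewrite lerBlDl; have /ltW := floorD1_gt a; rewrite intrD1.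
have -> : ri a (a + 1) f = ri r (r + 1) f.
  have -> : a = r + m%:~R by rewrite subrK.
  rewrite [X in ri _ X]addrAC ri_shift//; apply: eq_ri => x _; exact: per_int.
rewrite (@ri_cat _ r 1)//; last by rewrite lerDr.
rewrite -[X in ri X (r + 1)]add0r ri_shift//.
rewrite (@eq_ri _ 0 r _ f); last by move=> x _; exact: pf.
by rewrite addrC -ri_cat.
Qed.

Lemma ri_per_shift c f : loc f -> per f -> ri 0 1 (fun x => f (x + c)) = ri 0 1 f.
Proof. by move=> lf pf; rewrite -ri_shift// add0r addrC ri_per. Qed.

(** Cauchy-Schwarz against the constant 1: expand the integral of (f - c)^2 >= 0 with c the mean of
    f. A null set D has no mean and is treated apart. *)
Lemma Rintegral_sqr_le (D : set mR) (f : R -> R) : measurable D -> (mu D < +oo)%E ->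
  mu.-integrable D (EFin \o f) -> mu.-integrable D (EFin \o (fun x => f x ^+ 2)) ->
  (\int[mu]_(x in D) f x) ^+ 2 <= fine (mu D) * \int[mu]_(x in D) (f x ^+ 2).
Proof.
move=> mD Dfin hf hf2; have [D0|Dn0] := eqVneq (mu D) 0%E.
  rewrite D0 /= mul0r /Rintegral (_ : integral _ _ _ = 0%E) ?expr0n//.
  apply: null_set_integral => //; exact: (measurable_int mu hf).
set m := fine (mu D); have m0 : 0 < m.
  by rewrite fine_gt0// lt0e Dn0 measure_ge0 Dfin.
pose c := \int[mu]_(x in D) f x / m.
have h1 : mu.-integrable D (EFin \o (fun x => 2 * c * f x)).
  by apply: eq_integrable (integrableZl _ (2 * c) hf).
have hc : mu.-integrable D (EFin \o (fun=> c ^+ 2)).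
  apply/integrableP; split; first exact: measurable_cst.
  rewrite /= integral_cst//; apply: lte_mul_pinfty => //.
have h2 : mu.-integrable D (EFin \o (fun x => f x ^+ 2 - 2 * c * f x)).
  by apply: eq_integrable (integrableB _ hf2 h1).
have : 0 <= \int[mu]_(x in D) (f x ^+ 2 - 2 * c * f x + c ^+ 2).
  apply: Rintegral_ge0 => x _.
  have -> : f x ^+ 2 - 2 * c * f x + c ^+ 2 = (f x - c) ^+ 2 by ring.
  exact: sqr_ge0.
rewrite RintegralD// RintegralB// RintegralZl// Rintegral_cst// -/m.
move: (\int[mu]_(x in D) (f x ^+ 2)) => Q; rewrite /c.
move: (\int[mu]_(x in D) f x) => I.
have -> : Q - 2 * (I / m) * I + (I / m) ^+ 2 * m = Q - I ^+ 2 / m.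
  by field; rewrite gt_eqF.
by rewrite subr_ge0 ler_pdivrMr// mulrC.
Qed.

Lemma ri_sqr_le a b g : a <= b -> itg a b g -> itg a b (fun x => g x ^+ 2) ->
  (ri a b g) ^+ 2 <= (b - a) * ri a b (fun x => g x ^+ 2).
Proof.
rewrite le_eqVlt => /orP[/eqP <-|ab hg hg2]; first by rewrite !ri_aa mulr0 expr0n.
have e : mu `[a, b]%classic = (b - a)%:E.
  by rewrite lebesgue_measure_itv/= lte_fin ab.
have := @Rintegral_sqr_le `[a, b]%classic g (measurable_itv _) _ hg hg2.
by rewrite !riE e; apply; rewrite ltry.
Qed.

Definition primitive f t : R := if 0 <= t then ri 0 t f else - ri t 0 f.

Lemma prmB f s t : loc f -> s <= t -> primitive f t - primitive f s = ri s t f.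
Proof.
move=> [_ lf] st; rewrite /primitive; case: (leP 0 s) => s0.
  by rewrite (le_trans s0 st) (@ri_cat _ 0 s t)// addrAC subrr add0r.
case: leP => t0; first by rewrite opprK addrC -ri_cat// ltW.
by rewrite opprK addrC (@ri_cat _ s t 0)// ?addrK// ltW.
Qed.

Lemma prm_cont f : loc f -> continuous (primitive f).
Proof.
move=> lf x.
(* The base point x - 1 makes x interior to an interval on which the indefinite integral is
   continuous. *)
have hc : {within `[x - 1, x + 1], continuous (fun y => ri (x - 1) y f)}.
  have -> : (fun y => ri (x - 1) y f) = (fun y => \int[mu]_(t in `[x - 1, y]) f t).
    by apply/funext => y; rewrite riE.
  by apply: (@parameterized_integral_continuous R (x - 1) (x + 1) f);
    [lra|exact: lf.2].
have x11 : x - 1 < x + 1 by lra.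
have xin : x \in `]x - 1, x + 1[ by rewrite in_itv/=; apply/andP; split; lra.
have := @within_continuous_continuous R R R (x - 1) (x + 1) _ x x11 hc xin.

move=> hcx.
have hcx' : (fun y => primitive f (x - 1) + ri (x - 1) y f) @ x -->
    primitive f (x - 1) + ri (x - 1) x f.
  by apply: cvgD; [exact: cvg_cst|exact: hcx].
apply: (@cvg_trans _ ((fun y => primitive f (x - 1) + ri (x - 1) y f) @ x)).
  apply: near_eq_cvg; near=> y.
  rewrite -prmB//; first by rewrite addrCA subrr addr0.
  apply/ltW; near: y; apply: lt_nbhsr; lra.
have -> : primitive f x = primitive f (x - 1) + ri (x - 1) x f.
  by rewrite -prmB//; [ring|lra].
exact: hcx'.
Unshelve. all: by end_near. Qed.

(** Absolute continuity in integrated form: T matters up to a constant, g up to a null set. *)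
Definition is_primitive T g := loc g /\ forall s t, s <= t -> T t - T s = ri s t g.

Lemma prim_cont T g : is_primitive T g -> continuous T.
Proof.
move=> [lg h].
have -> : T = (fun t => T 0 + primitive g t).
  apply/funext => t; rewrite /primitive; case: leP => t0.
    by rewrite -h//; ring.
  by rewrite -h ?ltW//; ring.
by move=> x; apply: cvgD; [exact: cvg_cst|exact: prm_cont].
Qed.

Lemma prim_sqr_le T g s t : is_primitive T g -> loc (fun x => g x ^+ 2) -> s <= t ->
  (T t - T s) ^+ 2 <= (t - s) * ri s t (fun x => g x ^+ 2).
Proof. by move=> [lg h] lg2 st; rewrite h// ri_sqr_le//; [exact: lg.2|exact: lg2.2]. Qed.

Definition energy h T := ri 0 1 (fun s => ((T (s + h) - T s) / h) ^+ 2).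

Lemma cont_shift T c : continuous T -> continuous (fun s => T (s + c)).
Proof.
move=> cT x; apply: (@cvg_comp _ _ _ (fun s => s + c) T); last exact: cT.
by apply: cvgD; [exact: cvg_id|exact: cvg_cst].
Qed.

Lemma cont_dq T c h : continuous T ->
  continuous (fun s => ((T (s + c) - T s) / h) ^+ 2).
Proof.
move=> cT x; rewrite /continuous_at expr2; under eq_fun do rewrite expr2.
have hc : (fun s => (T (s + c) - T s) / h) @ x --> (T (x + c) - T x) / h.
  apply: cvgM; last exact: cvg_cst.
  by apply: cvgB; [exact: (cont_shift cT)|exact: cT].
exact: cvgM.
Qed.

(** On [s, s + h] Cauchy-Schwarz bounds the squared difference quotient by h^-1 (A (s + h) - A s),
    where A is a primitive of g^2. *)
Lemma energy_le T g h : is_primitive T g -> per g -> loc (fun x => g x ^+ 2) -> 0 < h <= 1 ->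
  energy h T <= ri 0 1 (fun x => g x ^+ 2).
Proof.
move=> pTg pg lg2 /andP[h0 h1]; have cT := prim_cont pTg.
pose A := primitive (fun x => g x ^+ 2); have cA : continuous A by exact: prm_cont.
have lA : loc A by exact: loc_cont.
have cAh := @cont_shift _ h cA; have lAh : loc (fun s => A (s + h)) by exact: loc_cont.
(* No Fubini is involved: moving the window [0, 1] to [h, 1 + h] leaves the integral over [0, h] of
   A (s + 1) - A s, which is constant by periodicity. The splittings use h <= 1. *)
have -> : ri 0 1 (fun x => g x ^+ 2) = ri 0 1 (fun s => h^-1 * (A (s + h) - A s)).
  have hB : itg 0 1 (fun s => A (s + h) - A s) by apply: itgB; [exact: lAh.2|exact: lA.2].
  rewrite riZ// riB; [|exact: lAh.2|exact: lA.2].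
  rewrite -ri_shift// add0r (@ri_cat _ h 1 (1 + h))//; [|by rewrite lerDl ltW|exact: lA.2].
  rewrite (@ri_cat _ 0 h 1 A (ltW h0) h1 (lA.2 0 1)).
  rewrite -[X in ri X (1 + h)]add0r (addrC 1 h) ri_shift//.
  have cancel (u v w : R) : u + v - (w + u) = v - w by ring.
  rewrite cancel.
  rewrite -riB; [|exact: (loc_shift 1 lA).2|exact: lA.2].
  rewrite (@eq_ri _ 0 h _ (fun=> ri 0 1 (fun x => g x ^+ 2))); last first.
    move=> x _; rewrite prmB ?lerDl// ri_per// => y; by rewrite pg.
  by rewrite (ri_cst _ (ltW h0)) subr0; field; rewrite gt_eqF.
apply: ri_le.
- apply: itg_cont; exact: cont_dq.
- by apply: itgZ; apply: itgB; [exact: lAh.2|exact: lA.2].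
- move=> s _; have sh : s <= s + h by rewrite lerDl ltW.
  have := prim_sqr_le pTg lg2 sh; rewrite addrAC subrr add0r -prmB// -/A => hh.
  rewrite expr_div_n ler_pdivrMr ?exprn_gt0//.
  move: hh; move: (A (s + h) - A s) => X hh.
  by have -> : h^-1 * X * h ^+ 2 = h * X by [field; rewrite gt_eqF].
Qed.

Lemma loc_locally g : loc g -> locally_integrable setT g.
Proof.
move=> [mg lg]; split=> //; first exact: openT.
move=> K _ cK; have [M [_ hM]] := compact_bounded cK.
have /integrableP[_] := lg (- (`|M| + 1)) (`|M| + 1); apply: le_lt_trans.
apply: ge0_subset_integral => //.
- exact: compact_measurable.
- by apply: (@measurable_funTS _ _ mR); do 2 apply: measurableT_comp => //.
- move=> x Kx; rewrite /= in_itv/= -ler_norml; apply: (hM (`|M| + 1)) => //.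
  by rewrite (le_lt_trans (ler_norm _))// ltrDl.
Qed.

Lemma ae_dq T g : is_primitive T g ->
  {ae mu, forall x, 0 <= x <= 1 ->
    (fun n => (T (x + n.+1%:R^-1) - T x) / n.+1%:R^-1) @ \oo --> g x}.
Proof.
move=> [lg h].
(* Starting the indefinite integral at -1 makes every point of [0, 1], in particular 0, interior. *)
have := @FTC1 R g (BLeft (-1)) (fun y => lg.2 (-1) y) (loc_locally lg).
apply: filterS; first exact: (ae_filter_ringOfSetsType mu).
move=> x /= + /andP[x0 x1].
move=> /(_ _)[]; first by rewrite lte_fin; lra.
pose F y := ri (-1) y g.
have -> : (fun y => \int[mu]_(t in `[(-1)%R, y]) g t) = F.
  by apply/funext => y; rewrite /F riE.
move=> dF <-.
have hF : (fun k => k^-1 * (F (k + x) - F x)) @ 0^' --> derive1 F x.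
  have -> : (fun k => k^-1 * (F (k + x) - F x)) =
     (fun k => k^-1 *: ((F \o shift x) (k *: 1) - F x)).
    by apply/funext => k; rewrite /= /GRing.scale/= mulr1.
  by rewrite derive1E; exact: dF.
have hn : (fun n => n.+1%:R^-1 : R) @ \oo --> 0^'.
  move=> P hP.
  have := @cvg_harmonic R _ (hP : nbhs 0 (fun y : R => y != 0 -> P y)).
  by move=> [N _ hN]; exists N => // n Nn; apply: (hN n Nn); rewrite invr_neq0.
have : ((fun k => k^-1 * (F (k + x) - F x)) \o (fun n => n.+1%:R^-1)) @ \oo -->
  derive1 F x by exact: (cvg_comp _ _ hn hF).
apply: cvg_trans; apply: near_eq_cvg; near=> n.
rewrite /= mulrC; congr (_ * _).
have n0 : 0 < n.+1%:R^-1 :> R by rewrite invr_gt0.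
rewrite addrC h; last by rewrite lerDl ltW.
have e : F (x + n.+1%:R^-1) = F x + ri x (x + n.+1%:R^-1) g.
  apply: ri_cat; [lra|by rewrite lerDl ltW|exact: lg.2].
by rewrite (addrC _ x) e addKr.
Unshelve. all: by end_near. Qed.

(** The integral of g^2 stays extended, so that the lemma applies before g^2 is known to be
    integrable; a uniform bound on the energies then proves that it is. *)
Lemma energy_liminf T g c : is_primitive T g ->
  (c%:E < \int[mu]_(x in `[0%R, 1%R]) (g x ^+ 2)%:E)%E ->
  \forall n \near \oo, c < energy n.+1%:R^-1 T.
Proof.
move=> pTg hc; have cT := prim_cont pTg; have [[mg _] _] := pTg.
pose f (n : nat) (x : mR) := (((T (x + n.+1%:R^-1) - T x) / n.+1%:R^-1) ^+ 2)%:E.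
have mfn n : measurable_fun (`[0, 1]%classic : set mR) (f n).
  apply/measurable_EFinP; apply: measurable_funTS.
  apply: continuous_measurable_fun; exact: cont_dq.
have := @fatou _ _ R mu `[0, 1]%classic (measurable_itv _) f mfn
  (fun n x _ => _ : (0 <= f n x)%E).
move=> /(_ (fun n x => sqr_ge0 _)) fat.
have {}hc : (c%:E < limn_einf (fun n => (energy n.+1%:R^-1 T)%:E))%E.
  apply: (lt_le_trans hc).
  apply: (@le_trans _ _ (\int[mu]_(x in `[0%R, 1%R]) limn_einf (f^~ x))%E).
    rewrite le_eqVlt; apply/orP; left; apply/eqP.
    apply: ae_eq_integral => //.
    - by apply/measurable_EFinP; apply: measurable_funTS; exact: measurable_funX.
    - apply: (emeasurable_fun_cvg (fun n x => einfs (f^~ x) n)); first exact: measurable_fun_einfs.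
      by move=> x _; rewrite limn_einf_lim; exact: is_cvg_einfs.
    - have := ae_dq pTg; apply: filterS; first exact: (ae_filter_ringOfSetsType mu).
      move=> x hx /=; rewrite in_itv/= => /hx {}hx.
      apply/esym/(cvg_limn_einf_sup _).1; apply: cvg_EFin; first exact: nearW.
      rewrite expr2 (_ : fine \o _ = fun n => ((T (x + n.+1%:R^-1) - T x) / n.+1%:R^-1)
        * ((T (x + n.+1%:R^-1) - T x) / n.+1%:R^-1)); first exact: cvgM.
      by apply/funext => n; rewrite /= expr2.
  apply: (le_trans fat); rewrite le_eqVlt; apply/orP; left; apply/eqP.
  congr limn_einf; apply/funext => n; rewrite -itgE//.
  by apply: itg_cont; exact: cont_dq.
move: hc; rewrite limn_einf_lim.
have -> := cvg_lim (@ereal_hausdorff R) (@cvg_einfs_sup R _).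
move=> /ereal_sup_gt[_ [n _ <-]] hn.
exists n => // k /= nk; rewrite -lte_fin (lt_le_trans hn)//.
by apply: ereal_inf_lbound; exists k.
Qed.

End Primitive.

(** * Weak convergence of derivatives from uniform convergence of primitives *)

Section WeakConvergence.
Context {R : realType}.
Notation mu := (@lebesgue_measure R).
Notation mR := (measurableTypeR R).
Implicit Types (a b c h s t x : R) (f g u v T S W : R -> R).

Definition L2 g := per g /\ loc g /\ loc (fun x => g x ^+ 2).

Lemma loc_le f g : mf setT f -> loc g -> (forall x, `|f x| <= g x) -> loc f.
Proof.
move=> hm lg fg; split=> // a b; apply: itg_le (lg.2 a b) => //.
exact: (measurable_funS measurableT (@subsetT _ _) hm).
Qed.

Lemma L2_mul f g : L2 f -> L2 g -> loc (fun x => f x * g x).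
Proof.
move=> [_ [[mf1 _] lf2]] [_ [[mg1 _] lg2]]; apply: (loc_le _ (locD lf2 lg2)).
  exact: measurable_funM.
move=> x; rewrite normrM -[f x ^+ 2]real_normK ?num_real// -[g x ^+ 2]real_normK ?num_real//.
have := normr_ge0 (f x); have := normr_ge0 (g x).
by move: `|f x| `|g x| => p q ? ?; have := sqr_ge0 (p - q); nra.
Qed.

Lemma L2_lin f g c : L2 f -> L2 g -> L2 (fun x => f x + c * g x).
Proof.
move=> hf hg; have [pf [lf lf2]] := hf; have [pg [lg lg2]] := hg; split.
  by move=> x; rewrite pf pg.
split; first by apply: locD => //; exact: locZ.
have -> : (fun x => (f x + c * g x) ^+ 2) =
  (fun x => f x ^+ 2 + ((2 * c) * (f x * g x) + c ^+ 2 * (g x ^+ 2))).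
  by apply/funext => x; ring.
by apply: locD => //; apply: locD; apply: locZ => //; exact: L2_mul.
Qed.

Definition ip f g := ri 0 1 (fun x => f x * g x).

Lemma ip_sqr f : ip f f = ri 0 1 (fun x => f x ^+ 2).
Proof. by apply: eq_ri => x _; rewrite expr2. Qed.

Lemma ip_lin f g u c : L2 f -> L2 g -> L2 u ->
  ip (fun x => f x + c * g x) u = ip f u + c * ip g u.
Proof.
move=> hf hg hu; rewrite /ip -riZ; last exact: (L2_mul hg hu).2.
rewrite -riD; [|exact: (L2_mul hf hu).2|by apply: itgZ; exact: (L2_mul hg hu).2].
by apply: eq_ri => x _; ring.
Qed.

Lemma ip_lin2 f g c : L2 f -> L2 g ->
  ip (fun x => f x + c * g x) (fun x => f x + c * g x) =
  ip f f + 2 * c * ip f g + c ^+ 2 * ip g g.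
Proof.
move=> hf hg; have i1 := (L2_mul hf hf).2 0 1; have i2 := (L2_mul hf hg).2 0 1.
have i3 := (L2_mul hg hg).2 0 1.
rewrite /ip -riZ// -riZ// -riD//; last exact: itgZ.
rewrite -riD//; [|by apply: itgD => //; exact: itgZ|exact: itgZ].
by apply: eq_ri => x _; ring.
Qed.

Lemma prim_lin T S f g c : is_primitive T f -> is_primitive S g ->
  is_primitive (fun x => T x + c * S x) (fun x => f x + c * g x).
Proof.
move=> [lf hT] [lg hS]; split; first by apply: locD => //; exact: locZ.
move=> s t st; rewrite riD; [|exact: lf.2|by apply: itgZ; exact: lg.2].
by rewrite riZ; [rewrite -hT// -hS//; ring|exact: lg.2].
Qed.

Definition ebil h T S :=
  ri 0 1 (fun s => ((T (s + h) - T s) / h) * ((S (s + h) - S s) / h)).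

Lemma cont_dq1 T h : continuous T -> continuous (fun s => (T (s + h) - T s) / h).
Proof.
move=> cT x; apply: cvgM; last exact: cvg_cst.
by apply: cvgB; [exact: (cont_shift cT)|exact: cT].
Qed.

Lemma energy_lin h T S c : continuous T -> continuous S ->
  energy h (fun x => T x + c * S x) =
  energy h T + (2 * c * ebil h T S + c ^+ 2 * energy h S).
Proof.
move=> cT cS; have dT := cont_dq1 (h := h) cT; have dS := cont_dq1 (h := h) cS.
have i1 : itg 0 1 (fun s => ((T (s + h) - T s) / h) ^+ 2) by apply/itg_cont/cont_dq.
have i2 : itg 0 1 (fun s => ((S (s + h) - S s) / h) ^+ 2) by apply/itg_cont/cont_dq.
have i3 : itg 0 1 (fun s => ((T (s + h) - T s) / h) * ((S (s + h) - S s) / h)).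
  by apply: itg_cont => x; apply: cvgM; [exact: dT|exact: dS].
rewrite /energy /ebil -riZ// -riZ// -riD; [|exact: itgZ|exact: itgZ].
rewrite -riD//; last by apply: itgD; exact: itgZ.
by apply: eq_ri => x _; ring.
Qed.

Lemma energy_ge0 h T : 0 <= energy h T.
Proof. by apply: ri_ge0 => x _; exact: sqr_ge0. Qed.

(* Q - E_h is a nonnegative quadratic form on pairs (T, g); this is its value at
   W + c S with the nonpositive term - E_h(W) dropped. *)
Lemma ebil_le W v S g c h : is_primitive W v -> is_primitive S g -> L2 v -> L2 g -> 0 < h <= 1 ->
  2 * c * ebil h W S <= ip v v + 2 * c * ip v g + c ^+ 2 * (ip g g - energy h S).
Proof.
move=> pW pS hv hg h01.
have hu := L2_lin c hv hg.
have := energy_le (prim_lin c pW pS) hu.1 hu.2.2 h01.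
rewrite energy_lin; [|exact: prim_cont pW|exact: prim_cont pS].
rewrite -ip_sqr ip_lin2//; have := energy_ge0 h W.
move: (energy h W) (energy h S) (ebil h W S) (ip v v) (ip v g) (ip g g).
by move=> ? ? ? ? ? ?; lra.
Qed.

(** Young's inequality with weight l for the form of [ebil_le], read at c = l and c = - l and
    divided by 2 l. The factor of l vanishes as h tends to 0 while v is only bounded, so l is to be
    taken large before h is taken small. *)
Lemma ip_small W v S g l h : is_primitive W v -> is_primitive S g -> L2 v -> L2 g -> 0 < h <= 1 ->
  0 < l ->
  `|ip v g| <= `|ebil h W S| + (ip v v / l + l * (ip g g - energy h S)) / 2.
Proof.
move=> pW pS hv hg h01 l0.
have := ebil_le l pW pS hv hg h01; have := ebil_le (- l) pW pS hv hg h01.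
move: (energy h S) (ebil h W S) (ip v v) (ip v g) (ip g g) => e b vv vg gg.
rewrite sqrrN => H1 H2.
have := ler_norm b; have := ler_norm (- b); rewrite normrN => n1 n2.
have d1 : b <= (vv / l + l * (gg - e)) / 2 + vg.
  rewrite -(ler_pM2l (_ : 0 < 2 * l)); last by rewrite mulr_gt0.
  have -> : 2 * l * ((vv / l + l * (gg - e)) / 2 + vg) =
    vv + 2 * l * vg + l ^+ 2 * (gg - e) by field; rewrite gt_eqF.
  by [].
have d2 : - b <= (vv / l + l * (gg - e)) / 2 - vg.
  rewrite -(ler_pM2l (_ : 0 < 2 * l)); last by rewrite mulr_gt0.
  have -> : 2 * l * ((vv / l + l * (gg - e)) / 2 - vg) =
    vv + 2 * (- l) * vg + l ^+ 2 * (gg - e) by field; rewrite gt_eqF.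
  by rewrite mulrN -mulNr -mulrN.
by move: d1 d2; set X := (_ / 2); rewrite ler_norml => d1 d2; apply/andP; split; lra.
Qed.

(** For fixed h a uniform bound e on W alone controls its difference quotients, by 2 e / h; no bound
    on the derivative of W enters. *)
Lemma ebil_bound W S h e : 0 < h -> continuous W -> continuous S ->
  (forall t, `|W t| <= e) ->
  `|ebil h W S| <= 2 * e / h * ri 0 1 (fun s => `|(S (s + h) - S s) / h|).
Proof.
move=> h0 cW cS hW; have dW := cont_dq1 (h := h) cW; have dS := cont_dq1 (h := h) cS.
have i3 : itg 0 1 (fun s => ((W (s + h) - W s) / h) * ((S (s + h) - S s) / h)).
  by apply: itg_cont => x; apply: cvgM; [exact: dW|exact: dS].
have i4 : itg 0 1 (fun s => `|(S (s + h) - S s) / h|) by apply/itg_norm/itg_cont.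
apply: (le_trans (ri_norm i3)); rewrite -riZ//; apply: ri_le.
- exact: itg_norm.
- exact: itgZ.
- move=> s _; rewrite normrM ler_wpM2r// normrM (ger0_norm (_ : 0 <= h^-1)); last first.
    by rewrite invr_ge0 ltW.
  rewrite ler_wpM2r ?invr_ge0 ?(ltW h0)//.
  by have := ler_normB (W (s + h)) (W s); have := hW (s + h); have := hW s; lra.
Qed.

Lemma weak_cvg (Tk gk : nat -> R -> R) T g S u (M : R) :
  (forall k, is_primitive (Tk k) (gk k)) -> (forall k, L2 (gk k)) ->
  (forall k, ip (gk k) (gk k) <= M) ->
  is_primitive T g -> L2 g -> ip g g <= M -> is_primitive S u -> L2 u ->
  (forall e : R, 0 < e -> \forall k \near \oo, forall t, `|Tk k t - T t| <= e) ->
  (fun k => ip (gk k) u) @ \oo --> ip g u.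
Proof.
move=> pk lk Mk pT lg Mg pS lu ucv; apply/cvgrPdist_le => e e0.
have M0 : 0 <= M by apply: le_trans Mg; rewrite ip_sqr ri_ge0// => x _; exact: sqr_ge0.
(* Order of choice: l makes the bounded term 4 M / l at most e / 2, then h makes l times the gap at
   most e / 2, then eta makes the pairing at most e / 4. The 1 keeps l positive when M = 0. *)
pose l := (8 * M + 1) / e; have l0 : 0 < l by rewrite divr_gt0//; lra.
have : \forall n \near \oo, ip u u - e / l / 2 < energy n.+1%:R^-1 S.
  apply: energy_liminf pS _.
  rewrite -itgE; last exact: lu.2.2.2.
  by rewrite lte_fin -ip_sqr ltrBlDr ltrDl; do 2 apply: divr_gt0 => //.
move=> [n _ /(_ n (leqnn n))]; set h := n.+1%:R^-1 => hE.
have h0 : 0 < h by rewrite invr_gt0.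
have h1 : h <= 1 by rewrite invf_le1// ler1n.
have cS := prim_cont pS.
pose B := ri 0 1 (fun s => `|(S (s + h) - S s) / h|) + 1.
have B1 : 0 < B by rewrite ltr_wpDl// ri_ge0.
pose eta := e * h / (8 * B); have eta0 : 0 < eta by rewrite divr_gt0// mulr_gt0.
have [N _ hN] := ucv eta eta0.
exists N => // k /= Nk; have {hN} hk := hN k Nk.
have pW := prim_lin (-1) (pk k) pT; have lv := L2_lin (-1) (lk k) lg.
(* |g_k - g|^2 <= 2 |g_k|^2 + 2 |g|^2, because the square of g_k + g is nonnegative. *)
have vv : ip (fun x => gk k x + -1 * g x) (fun x => gk k x + -1 * g x) <= 4 * M.
  have : 0 <= ip (fun x => gk k x + 1 * g x) (fun x => gk k x + 1 * g x).
    by rewrite ip_sqr ri_ge0// => x _; exact: sqr_ge0.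
  have lv' := L2_lin 1 (lk k) lg.
  rewrite !ip_lin2//; have := Mk k.
  by move: (ip (gk k) (gk k)) (ip g g) (ip (gk k) g) Mg => ? ? ? ? ? ?; lra.
have := ip_small pW pS lv lu (_ : 0 < h <= 1) l0; rewrite h0 h1 => /(_ isT) hs.
have <- : `|ip (fun x => gk k x + -1 * g x) u| = `|ip g u - ip (gk k) u|.
  by rewrite ip_lin// mulN1r distrC.
apply: (le_trans hs).
have heta t : `|Tk k t + -1 * T t| <= eta by rewrite mulN1r.
have := ebil_bound h0 (prim_cont pW) cS heta.
set eb := `|ebil _ _ _| => heb.
have heb' : eb <= e / 4.
  apply: (le_trans heb); apply: (@le_trans _ _ (2 * eta / h * B)).
    apply: ler_wpM2l; last by rewrite lerDl.
    by apply: divr_ge0; [apply: mulr_ge0 => //; exact: ltW|exact: ltW].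
  by rewrite /eta le_eqVlt; apply/orP; left; apply/eqP; field; rewrite !gt_eqF.
have t1 : ip (fun x => gk k x + -1 * g x) (fun x => gk k x + -1 * g x) / l <= e / 2.
  rewrite ler_pdivrMr//; apply: (le_trans vv).
  have -> : e / 2 * l = (8 * M + 1) / 2 by rewrite /l; field; rewrite gt_eqF.
  by lra.
have t2 : l * (ip u u - energy h S) <= e / 2.
  rewrite -ler_pdivlMl//.
  have -> : l^-1 * (e / 2) = e / l / 2 by field; rewrite gt_eqF.
  by move: hE; move: (ip u u) (energy h S) => ? ? ?; lra.
move: t1 t2 heb'; move: (_ / l) (l * _) eb heb => p q eb heb.
by move=> ? ? ?; lra.
Qed.

End WeakConvergence.

(** * Limits along an ultrafilter *)

Lemma ultra_map {X Y : Type} (f : X -> Y) (F : set_system X) :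
  UltraFilter F -> UltraFilter (f @ F).
Proof.
move=> UF; have PF : ProperFilter (f @ F) by exact: fmap_proper_filter.
split=> // G PG sG; apply/seteqP; split; last exact: sG.
move=> A GA; have [//|nA] := in_ultra_setVsetC (f @^-1` A) UF.
have GnA : G (~` A) by apply: sG; exact: nA.
have G0 : G set0 by rewrite -(setICr A); exact: filterI.
by have := filter_not_empty G G0.
Qed.

Section Ultralimit.
Context {R : realType}.

Lemma ultra_lim (F : set_system nat) (x : nat -> R) B : UltraFilter F ->
  (forall j, `|x j| <= B) -> exists l : R, x @ F --> l.
Proof.
move=> UF hB; have := @segment_compact R (- B) B; rewrite compact_ultra.
move=> /(_ (x @ F) (ultra_map x UF)) [|l [_ hl]]; last by exists l.
by apply: (@filterS _ F _ setT); [move=> j _ /=; rewrite in_itv/= -ler_norml|exact: filterT].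
Qed.

Lemma ultra_le (F : set_system nat) (x : nat -> R) (l c : R) : UltraFilter F ->
  (forall j, x j <= c) -> x @ F --> l -> l <= c.
Proof.
move=> UF hc hl; have PF : ProperFilter F by exact: ultra_proper.
apply: (@closed_cvg _ _ F PF x [set y | y <= c] (@closed_le _ c) _ l hl).
exact: nearW.
Qed.

End Ultralimit.

(** * A density for the ultralimit of integrals bounded in L^2 *)

Section WeakLimit.
Context {R : realType}.
Notation mu := (@lebesgue_measure R).
Notation mR := (measurableTypeR R).
Notation I := (`[0, 1]%classic : set mR).

Variables (F : set_system nat) (gk : nat -> R -> R) (M : R).
Hypothesis UF : UltraFilter F.
Hypothesis hg : forall j, itg 0 1 (gk j).
Hypothesis hg2 : forall j, itg 0 1 (fun x => gk j x ^+ 2).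
Hypothesis gM : forall j, ri 0 1 (fun x => gk j x ^+ 2) <= M.

Let PF : ProperFilter F. Proof. exact: ultra_proper. Qed.

Let J (A : set mR) j : R := \int[mu]_(x in A `&` I) gk j x.

Let muI : mu I = 1%E.
Proof. by rewrite lebesgue_measure_itv/= lte_fin ltr01 sube0. Qed.

Let mAI (A : set mR) : measurable A -> measurable (A `&` I).
Proof. by move=> mA; exact: measurableI. Qed.

Let muAI (A : set mR) : measurable A -> (mu (A `&` I) <= 1)%E.
Proof.
move=> mA; rewrite -muI; apply: le_measure; rewrite ?inE//; exact: mAI.
Qed.

Let gI (A : set mR) j : measurable A -> mu.-integrable (A `&` I) (EFin \o gk j).
Proof.
move=> mA; apply: integrableS (hg j) => //; exact: mAI.
Qed.

(** Cauchy-Schwarz gives absolute continuity uniformly in j. This one estimate makes the ultralimit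
    exist, countably additive and dominated by Lebesgue measure. *)
Let J_sqr A j : measurable A -> J A j ^+ 2 <= fine (mu (A `&` I)) * M.
Proof.
move=> mA.
have h2 : mu.-integrable (A `&` I) (EFin \o (fun x => gk j x ^+ 2)).
  by apply: integrableS (hg2 j) => //; exact: mAI.
have := @Rintegral_sqr_le R (A `&` I) (gk j) (mAI mA) _ (gI j mA) h2.
move=> /(_ (le_lt_trans (muAI mA) (ltry _))) h.
apply: (le_trans h); rewrite ler_wpM2l ?fine_ge0//; apply: le_trans (gM j).
rewrite riE /Rintegral fine_le//.
- by apply: integrable_fin_num => //; exact: mAI.
- exact: integrable_fin_num (hg2 j).
- apply: ge0_subset_integral => //; first exact: mAI.
  + exact: measurable_int (hg2 j).
  + by move=> x _; rewrite lee_fin sqr_ge0.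
Qed.

Let M0 : 0 <= M.
Proof. by apply: le_trans (gM 0); apply: ri_ge0 => x _; exact: sqr_ge0. Qed.

Let J_cvg A : measurable A -> exists l : R, J A @ F --> l.
Proof.
(* Squares are compared, and M <= (M + 1)^2 holds whether or not M >= 1; hence the bound M + 1. *)
move=> mA; apply: (@ultra_lim R F (J A) (M + 1) UF) => j.
rewrite -[_ <= _]ler_sqr ?nnegrE ?addr_ge0// real_normK ?num_real//.
apply: (le_trans (J_sqr j mA)); apply: (@le_trans _ _ M).
  by rewrite ler_piMl// -lee_fin fineK ?muAI// ge0_fin_numE// (le_lt_trans (muAI mA))// ltry.
by have := M0; nra.
Qed.

(** Along an ultrafilter this limit exists on the whole sigma-algebra at once; a subsequence would
    call for a countable generating family. *)
Let L A : R := lim (J A @ F).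

Let L_cvg A : measurable A -> J A @ F --> L A.
Proof.
by move=> /J_cvg[l hl]; rewrite /L (cvg_lim _ hl)//; exact: Rhausdorff.
Qed.

Let L_sqr A : measurable A -> L A ^+ 2 <= fine (mu (A `&` I)) * M.
Proof.
move=> mA; have hL := L_cvg mA.
have h2 : (fun j => J A j * J A j) @ F --> L A * L A by exact: cvgM.
rewrite expr2; apply: (ultra_le UF _ h2) => j.
by rewrite -expr2 J_sqr.
Qed.

Let L_add A B : measurable A -> measurable B -> A `&` B = set0 ->
  L (A `|` B) = L A + L B.
Proof.
move=> mA mB AB; have mAB : measurable (A `|` B) by exact: measurableU.
have e : J (A `|` B) = (fun j => J A j + J B j).
  apply/funext => j; rewrite /J setIUl Rintegral_setU//; try exact: mAI.
    by rewrite -setIUl; exact: gI.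
  by apply/disj_setPS => x [[Ax _] [Bx _]]; rewrite -AB.
apply: (@cvg_unique _ (@Rhausdorff R) (J (A `|` B) @ F)); first exact: L_cvg.
by rewrite e; apply: cvgD; exact: L_cvg.
Qed.

Let L0 : L set0 = 0.
Proof.
have := L_sqr measurable0; rewrite set0I measure0 mul0r => h.
by apply/eqP; rewrite -sqrf_eq0 eq_le h sqr_ge0.
Qed.

Let nu (A : set mR) : \bar R := (L A)%:E.

(** The tails of a disjoint union decrease to the empty set within finite measure, so their measures
    tend to 0 and [L_sqr] forces L of the tails to 0. *)
Let nu_sigma : semi_sigma_additive nu.
Proof.
move=> A mA tA mU; rewrite /nu.
have mS n : measurable (\big[setU/set0]_(i < n) A i) by exact: bigsetU_measurable.
have LS n : L (\big[setU/set0]_(i < n) A i) = \sum_(i < n) L (A i).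
  elim: n => [|n IH]; first by rewrite !big_ord0.
  rewrite !big_ord_recr/= L_add ?IH//; first exact: mS.
  apply: (@trivIset_bigsetUI _ predT A _ n n) => //.
  by move=> i j _ _; exact: tA.
pose t n := \bigcup_i A i `\` \big[setU/set0]_(i < n) A i.
have mt n : measurable (t n) by exact: measurableD.
have sub n : \big[setU/set0]_(i < n) A i `<=` \bigcup_i A i.
  by rewrite -bigcup_mkord => x [i _ Ax]; exists i.
have Lt n : L (\bigcup_i A i) = \sum_(i < n) L (A i) + L (t n).
  rewrite -LS -L_add//; first by rewrite setDUK//; exact: sub.
  by rewrite /t setDE setICA setICr setI0.
have hmu : (fun n => fine (mu (t n `&` I))) @ \oo --> (0 : R).
  have cap0 : \bigcap_n (t n `&` I) = set0.
    rewrite -subset0 => x hx; have [[[i _ Aix] _] _] := hx 0%N Logic.I.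
    have [[_ nx] _] := hx i.+1 Logic.I; apply: nx.
    by rewrite -bigcup_mkord; exists i => //=.
  have h := @nonincreasing_cvg_mu _ _ _ mu (fun n => t n `&` I).
  suff : mu (t n `&` I) @[n --> \oo] --> 0%:E by move/fine_cvg.
  rewrite cap0 measure0 in h; apply: h.
  - exact: le_lt_trans (muAI (mt 0%N)) (ltry _).
  - by move=> n; exact: mAI.
  - by [].
  - move=> n m nm; apply/subsetPset; apply: setSI; apply: setDS.
    by rewrite -!bigcup_mkord; apply: bigcup_subset => i /= /leq_trans; apply.
under eq_fun do rewrite big_mkord sumEFin.
apply: cvg_EFin; first exact: nearW.
apply/cvgrPdist_lt => e e0.
have eM : 0 < e ^+ 2 / (M + 1) by rewrite divr_gt0 ?exprn_gt0// ltr_wpDl// M0.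
move/cvgrPdist_lt: hmu => /(_ _ eM); apply: filterS => n.
rewrite sub0r normrN ger0_norm ?fine_ge0// ltr_pdivlMr ?ltr_wpDl ?M0// => hn /=.
rewrite (Lt n) addrAC subrr add0r.
rewrite -[_ < _]ltr_sqr ?nnegrE ?(ltW e0)// real_normK ?num_real//.
apply: le_lt_trans (L_sqr (mt n)) _; apply: le_lt_trans hn.
by rewrite ler_wpM2l ?fine_ge0// lerDl.
Qed.

Let nu_fin A : measurable A -> nu A \is a fin_num. Proof. by []. Qed.

Let nu0 : nu set0 = 0%E. Proof. by rewrite /nu L0. Qed.

(** Radon-Nikodym yields an integrable density only; its square integrability is recovered in
    [compactness] from the energies. *)
Lemma weak_limit : exists g : R -> R, itg 0 1 g /\
  forall s t, 0 <= s -> s <= t -> t <= 1 -> (fun j => ri s t (gk j)) @ F --> ri s t g.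
Proof.
pose nuC : {charge set mR -> \bar R} :=
  HB.pack nu (isCharge.Build _ _ _ nu nu0 nu_fin nu_sigma).
have numu : nuC `<< mu.
  apply/null_content_dominatesP => A mA A0; rewrite /= /nu; congr EFin.
  have := L_sqr mA.
  have -> : mu (A `&` I) = 0%E.
    apply/eqP; rewrite eq_le measure_ge0 andbT -A0; apply: le_measure; rewrite ?inE//.
    exact: mAI.
  by rewrite mul0r => h; apply/eqP; rewrite -sqrf_eq0 eq_le h sqr_ge0.
pose f := Radon_Nikodym nuC mu.
pose g x := fine (f x).
have fg x : (g x)%:E = f x by rewrite fineK//; exact: Radon_Nikodym_fin_num.
have intf : mu.-integrable setT f by exact: Radon_Nikodym_integrable.
have intg : itg 0 1 g.
  rewrite /itg (_ : EFin \o g = f); last exact/funext.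
  exact: integrableS intf.
exists g; split=> // s t s0 st t1.
have -> : ri s t g = L `[s, t]%classic.
  have := @Radon_Nikodym_integral _ _ _ nuC mu `[s, t]%classic numu (measurable_itv _).
  rewrite riE /Rintegral; under eq_integral do rewrite fg.
  by rewrite -/f => <-.
have -> : (fun j => ri s t (gk j)) = J `[s, t]%classic.
  apply/funext => j; rewrite /J setIidl ?riE//.
  by apply: subset_itv; rewrite bnd_simp.
exact: L_cvg.
Qed.

End WeakLimit.

(** * Vectors in R^3 and components of W^{2,2} curves *)

Section Curves.
Context {R : realType}.
Notation mu := (@lebesgue_measure R).
Notation mR := (measurableTypeR R).
Notation cp := (@Defs.comp R).
Implicit Types (u v w e : V3 R) (gamma beta : R -> V3 R).

Lemma sum3E (f : 'I_3 -> R) : \sum_(i < 3) f i = f (inord 0) + f (inord 1) + f (inord 2).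
Proof.
rewrite !big_ord_recl big_ord0 addr0 addrA; congr (_ + _ + _); congr f;
  by apply/val_inj; rewrite /= inordK.
Qed.

Lemma dot3E u v :
  dot3 u v = cp u 0 * cp v 0 + cp u 1 * cp v 1 + cp u 2 * cp v 2.
Proof. exact: sum3E. Qed.

Lemma comp_cross u v : [/\ cp (cross u v) 0 = cp u 1 * cp v 2 - cp u 2 * cp v 1,
  cp (cross u v) 1 = cp u 2 * cp v 0 - cp u 0 * cp v 2 &
  cp (cross u v) 2 = cp u 0 * cp v 1 - cp u 1 * cp v 0].
Proof. by split; rewrite {1}/Defs.comp mxE !inordK. Qed.

(** Lagrange's identity. *)
Lemma dot3_cross u v :
  dot3 (cross u v) (cross u v) = dot3 u u * dot3 v v - dot3 u v ^+ 2.
Proof. by have [e0 e1 e2] := comp_cross u v; rewrite !dot3E e0 e1 e2; ring. Qed.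

Lemma dot3_ge0 u : 0 <= dot3 u u.
Proof. by rewrite dot3E; apply: addr_ge0; [apply: addr_ge0|]; rewrite -expr2 sqr_ge0. Qed.

Lemma enorm_sqr u : enorm u ^+ 2 = dot3 u u.
Proof. by rewrite sqr_sqrtr// dot3_ge0. Qed.

Lemma enorm_ge0 u : 0 <= enorm u. Proof. exact: sqrtr_ge0. Qed.

(** The part of a chord along the tangent u does not contribute to the cross product, so the chord h
    u + e counts only through its remainder e. *)
Lemma dot3_cross_le u e h :
  dot3 (cross u (h *: u + e)) (cross u (h *: u + e)) <= dot3 u u * dot3 e e.
Proof.
have -> : dot3 (cross u (h *: u + e)) (cross u (h *: u + e)) =
  dot3 u u * dot3 e e - dot3 u e ^+ 2.
  by rewrite dot3_cross !dot3E /Defs.comp !mxE; ring.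
by rewrite gerBl sqr_ge0.
Qed.

Lemma comp_sqr_le u i : u 0 i ^+ 2 <= dot3 u u.
Proof.
rewrite /dot3 (bigD1 i)//= -expr2 lerDl; apply: sumr_ge0 => j _.
by rewrite -expr2 sqr_ge0.
Qed.

Lemma comp_le_enorm u i : `|u 0 i| <= enorm u.
Proof. by rewrite -sqrtr_sqr ler_wsqrtr// comp_sqr_le. Qed.

(** The constant 2 replaces sqrt 3. *)
Lemma enorm_le_max u (B : R) : 0 <= B -> (forall i, `|u 0 i| <= B) -> enorm u <= 2 * B.
Proof.
move=> B0 hB; rewrite -(ger0_norm (mulr_ge0 _ B0))// -sqrtr_sqr ler_wsqrtr// /dot3 sum3E.
have h i : u 0 i * u 0 i <= B ^+ 2.
  by rewrite -expr2 -real_normK ?num_real// lerXn2r ?nnegrE.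
have := h (inord 0); have := h (inord 1); have := h (inord 2).
have := sqr_ge0 B; nra.
Qed.

Lemma derivable_comp gamma i t : derivable gamma t 1 ->
  derivable (fun s => gamma s 0 i) t 1.
Proof. by move=> /derivable_mxP; exact. Qed.

Lemma derive1_comp gamma i t : derivable gamma t 1 ->
  derive1 gamma t 0 i = derive1 (fun s => gamma s 0 i) t.
Proof. by move=> d; rewrite !derive1E derive_mx// mxE. Qed.

Lemma is_derive_comp gamma i t : derivable gamma t 1 ->
  is_derive t 1 (fun s => gamma s 0 i) (derive1 gamma t 0 i).
Proof.
move=> d; rewrite derive1_comp// derive1E; apply/derivableP; exact: derivable_comp.
Qed.

Lemma derive1_per gamma : periodic1 gamma -> periodic1 (derive1 gamma).
Proof.
move=> pg t; rewrite /derive1.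
by have -> : (fun h => h^-1 *: (gamma (h + (t + 1)) - gamma (t + 1))) =
    (fun h => h^-1 *: (gamma (h + t) - gamma t)) by apply/funext => h; rewrite addrA !pg.
Qed.

Lemma sqr_itg (a b : R) (f : R -> R) : mf `[a, b]%classic f ->
  itg a b (fun x => f x ^+ 2) -> itg a b f.
Proof.
move=> hm h2; apply: (itg_le hm _ (itgD h2 (_ : itg a b (fun=> 1)))).
  by move=> x _; rewrite -[f x ^+ 2]real_normK ?num_real//; have := sqr_ge0 (`|f x| - 1); nra.
by apply: itg_cont => x; exact: cvg_cst.
Qed.

Lemma wdd_L2 gamma g i : is_wdd gamma g -> L2 (fun x => g x 0 i).
Proof.
move=> [pg [mg [fin _]]].
have hm : mf `[0, 1]%classic (fun x => g x 0 i) by exact: mg.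
have p : per (fun x => g x 0 i) by move=> x; rewrite pg.
have mn : measurable_fun (`[0, 1]%classic : set mR) (fun x => (enorm (g x) ^+ 2)%:E).
  apply/measurable_EFinP.
  rewrite (_ : (fun x => _) = (fun x => \sum_(j < 3) g x 0 j * g x 0 j)); last first.
    by apply/funext => x; rewrite enorm_sqr.
  by apply: measurable_sum => j; apply: measurable_funM; exact: mg.
have h2 : itg 0 1 (fun x => g x 0 i ^+ 2).
  apply/integrableP; split; first by apply/measurable_EFinP; exact: measurable_funX.
  apply: le_lt_trans fin; apply: ge0_le_integral => //.
  - by apply: measurableT_comp => //; apply/measurable_EFinP; exact: measurable_funX.
  - by move=> x _; rewrite lee_fin ger0_norm ?sqr_ge0// enorm_sqr comp_sqr_le.
split=> //; split; first by apply: loc_per => //; exact: sqr_itg.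
by apply: loc_per => // x; rewrite p.
Qed.

Lemma wdd_prim gamma g i : is_wdd gamma g ->
  is_primitive (fun t => derive1 gamma t 0 i) (fun x => g x 0 i).
Proof.
move=> hw; split; first exact: (wdd_L2 i hw).2.1.
move=> s t st; have [_ [_ [_ /(_ s t st) h]]] := hw.
by have := congr1 (fun v : V3 R => v 0 i) h; rewrite !mxE riE.
Qed.

Lemma d2P gamma : W22 gamma -> is_wdd gamma (d2 gamma).
Proof. by move=> [_ [_ hg]]; exact: (ClassicalEpsilon.epsilon_spec _ _ hg). Qed.

Lemma W22_L2 gamma i : W22 gamma -> L2 (fun x => d2 gamma x 0 i).
Proof. by move=> /d2P; exact: wdd_L2. Qed.

Lemma W22_prim gamma i : W22 gamma ->
  is_primitive (fun t => derive1 gamma t 0 i) (fun x => d2 gamma x 0 i).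
Proof. by move=> /d2P; exact: wdd_prim. Qed.

Lemma W22_cont1 gamma i : W22 gamma -> continuous (fun t => derive1 gamma t 0 i).
Proof. by move=> /(W22_prim i); exact: prim_cont. Qed.

Lemma W22_cont gamma i : W22 gamma -> continuous (fun t => gamma t 0 i).
Proof.
move=> [_ [d _]] t; apply: differentiable_continuous; apply/derivable1_diffP.
exact: derivable_comp.
Qed.

(** Mean value theorem in one coordinate. Both orders of s and t are allowed because the
    tangent-point radius looks at chords on both sides of s. *)
Lemma taylor1 gamma i (s t D : R) : W22 gamma ->
  (forall x, Num.min s t <= x <= Num.max s t ->
     `|derive1 gamma x 0 i - derive1 gamma s 0 i| <= D) ->
  `|gamma t 0 i - gamma s 0 i - (t - s) * derive1 gamma s 0 i| <= `|t - s| * D.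
Proof.
move=> hW; have [_ [d _]] := hW.
have mvt a b : a <= b -> exists2 c, a <= c <= b &
    gamma b 0 i - gamma a 0 i = derive1 gamma c 0 i * (b - a).
  move=> ab; have := @MVT_segment R (fun t => gamma t 0 i)
    (fun t => derive1 gamma t 0 i) a b ab.
  move=> [].
  - by move=> x _; exact: is_derive_comp.
  - by apply: continuous_subspaceT; exact: W22_cont.
  - by move=> c; rewrite in_itv/= => hc e; exists c.
move=> hD; have [st|ts] := leP s t.
  have [c cst e] := mvt s t st; move: hD; rewrite min_l// max_r// => /(_ c cst).
  rewrite e mulrC -mulrBr normrM => hc; exact: ler_wpM2l.
have [c cst e] := mvt t s (ltW ts); move: hD; rewrite min_r ?max_l ?(ltW ts)// => /(_ c cst).
have -> : gamma t 0 i - gamma s 0 i = (t - s) * derive1 gamma c 0 i.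
  by rewrite -opprB e; ring.
rewrite -mulrBr normrM => hc; exact: ler_wpM2l.
Qed.

End Curves.

(** * Dyadic scales and the pointwise Bellman inequality *)

Section Dyadic.
Context {R : realType}.

Definition dyadic (n : nat) : R := (2^-1) ^+ n.

Lemma dy_gt0 n : 0 < dyadic n. Proof. by rewrite exprn_gt0// invr_gt0. Qed.

Lemma dyE n : dyadic n = (2 ^+ n)^-1. Proof. by rewrite /dyadic exprVn. Qed.

Lemma dyS n : dyadic n = dyadic n.+1 + dyadic n.+1.
Proof. by rewrite /dyadic exprS; field. Qed.

Lemma cont_exp (f : R -> R) n : continuous f -> continuous (fun x => f x ^+ n).
Proof.
move=> cf; elim: n => [|n IH] x; first exact: cvg_cst.
rewrite /continuous_at exprS; under eq_fun do rewrite exprS.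
by apply: cvgM; [exact: cf|exact: IH].
Qed.

(** Here p, q are the increments of G over the two halves of a window, P, Q those of A, and x = 2^n;
    the hypotheses are Cauchy-Schwarz on the halves. They give 4 x^2 p^2 q^2 <= P Q, and what
    remains has the gap x^2 (2 (p - q)^4 + 24 p^2 q^2). *)
Lemma bellman_pt (x p q P Q : R) : 0 <= x -> 0 <= p -> 0 <= q ->
  2 * x * p ^+ 2 <= P -> 2 * x * q ^+ 2 <= Q ->
  x ^+ 2 * (2 * (p + q) ^+ 4 - 4 * (p ^+ 4 + q ^+ 4)) <= 12 * (P * Q).
Proof.
move=> x0 p0 q0 hP hQ.
have h : (2 * x * p ^+ 2) * (2 * x * q ^+ 2) <= P * Q.
  by apply: ler_pM => //; rewrite !mulr_ge0 ?sqr_ge0.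
apply: (@le_trans _ _ (12 * ((2 * x * p ^+ 2) * (2 * x * q ^+ 2)))); last by rewrite ler_pM2l.
rewrite -subr_ge0.
have -> : 12 * (2 * x * p ^+ 2 * (2 * x * q ^+ 2)) -
  x ^+ 2 * (2 * (p + q) ^+ 4 - 4 * (p ^+ 4 + q ^+ 4)) =
  x ^+ 2 * (2 * (p ^+ 2 + q ^+ 2 - 2 * (p * q)) ^+ 2 + 24 * (p * q) ^+ 2) by ring.
by rewrite mulr_ge0 ?sqr_ge0// addr_ge0// mulr_ge0 ?sqr_ge0.
Qed.

Lemma ri_lin3 (c1 c2 c3 : R) (f1 f2 f3 : R -> R) :
  continuous f1 -> continuous f2 -> continuous f3 ->
  ri 0 1 (fun s => c1 * f1 s + (c2 * f2 s + c3 * f3 s)) =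
  c1 * ri 0 1 f1 + (c2 * ri 0 1 f2 + c3 * ri 0 1 f3).
Proof.
move=> k1 k2 k3.
have i1 := @itg_cont _ 0 1 _ k1; have i2 := @itg_cont _ 0 1 _ k2.
have i3 := @itg_cont _ 0 1 _ k3.
rewrite riD; [|exact: itgZ|by apply: itgD; exact: itgZ].
by rewrite riD; [rewrite !riZ|exact: itgZ|exact: itgZ].
Qed.

Lemma pow8 n : 8 ^+ n = 2 ^+ n * (2 ^+ n) ^+ 2 :> R.
Proof.
by elim: n => [|n IH]; [rewrite !expr0; ring|rewrite !exprS IH; ring].
Qed.

End Dyadic.

(** * Summation over dyadic scales by a decreasing potential *)

Section Bellman.
Context {R : realType}.
(** G stands for a primitive of a periodic f >= 0 and A for one of f^2; [GA] is Cauchy-Schwarz. *)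
Variables (G A : R -> R) (cG cA : R).
Hypothesis contG : continuous G.
Hypothesis contA : continuous A.
Hypothesis perG : forall s, G (s + 1) = G s + cG.
Hypothesis perA : forall s, A (s + 1) = A s + cA.
Hypothesis monoG : forall s t, s <= t -> 0 <= G t - G s.
Hypothesis GA : forall s t, s <= t -> (G t - G s) ^+ 2 <= (t - s) * (A t - A s).

Notation dyadic := (@dyadic R).
Let phi n s := G (s + dyadic n) - G s.
Let chi n s := A (s + dyadic n) - A s.

Let cont_phi n : continuous (phi n).
Proof. by move=> x; apply: cvgB; [exact: (cont_shift contG)|exact: contG]. Qed.

Let cont_chi n : continuous (chi n).
Proof. by move=> x; apply: cvgB; [exact: (cont_shift contA)|exact: contA]. Qed.

Let per_phi n : per (phi n).
Proof. by move=> x; rewrite /phi addrAC !perG; ring. Qed.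

Let per_chi n : per (chi n).
Proof. by move=> x; rewrite /chi addrAC !perA; ring. Qed.

Let a n := ri 0 1 (fun s => phi n s ^+ 4).
Let b n := ri 0 1 (fun s => chi n s ^+ 2).

Let phi_le_chi n s : 2 ^+ n * phi n s ^+ 2 <= chi n s.
Proof.
have := @GA s (s + dyadic n); rewrite lerDl (ltW (dy_gt0 n)) => /(_ isT).
have -> : s + dyadic n - s = dyadic n by ring.
by rewrite [X in _ <= X * _]dyE ler_pdivlMl ?exprn_gt0.
Qed.

Let phi_ge0 n s : 0 <= phi n s.
Proof. by apply: monoG; rewrite lerDl (ltW (dy_gt0 n)). Qed.

(** When a window is halved, chi_n^2 exceeds the sum of the squares of its two parts by twice their
    product P Q, so the right side is the integral of 12 P Q and [bellman_pt] applies pointwise. By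
    periodicity both halves have the same integral. *)
Let bellman_step n :
  (2 ^+ n) ^+ 2 * (2 * a n - 8 * a n.+1) <= 6 * b n - 12 * b n.+1.
Proof.
set x := 2 ^+ n : R; have x0 : 0 <= x by rewrite exprn_ge0.
have c1 := cont_exp (n := 4) (@cont_phi n); have c2 := cont_exp (n := 4) (@cont_phi n.+1).
have c3 := @cont_shift _ _ (dyadic n.+1) c2.
have d1 := cont_exp (n := 2) (@cont_chi n); have d2 := cont_exp (n := 2) (@cont_chi n.+1).
have d3 := @cont_shift _ _ (dyadic n.+1) d2.
have sa : ri 0 1 (fun s => phi n.+1 (s + dyadic n.+1) ^+ 4) = a n.+1.
  apply: (@ri_per_shift _ (dyadic n.+1) (fun s => phi n.+1 s ^+ 4)); first exact: loc_cont.
  by move=> s; rewrite per_phi.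
have sb : ri 0 1 (fun s => chi n.+1 (s + dyadic n.+1) ^+ 2) = b n.+1.
  apply: (@ri_per_shift _ (dyadic n.+1) (fun s => chi n.+1 s ^+ 2)); first exact: loc_cont.
  by move=> s; rewrite per_chi.
(* Two copies are written so that one can be replaced by its translate by half a window. *)
have -> : x ^+ 2 * (2 * a n - 8 * a n.+1) =
    2 * x ^+ 2 * a n + (- (4 * x ^+ 2) * a n.+1 + - (4 * x ^+ 2) * a n.+1).
  by move: (a n) (a n.+1) => ? ?; ring.
have -> : 6 * b n - 12 * b n.+1 = 6 * b n + (- 6 * b n.+1 + - 6 * b n.+1).
  by move: (b n) (b n.+1) => ? ?; ring.
rewrite -{2}sa -{2}sb -!ri_lin3//.
apply: ri_le.
- apply: itg_cont => y; apply: cvgD; first by apply: cvgM; [exact: cvg_cst|exact: c1].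
  apply: cvgD; first by apply: cvgM; [exact: cvg_cst|exact: c2].
  by apply: cvgM; [exact: cvg_cst|exact: c3].
- apply: itg_cont => y; apply: cvgD; first by apply: cvgM; [exact: cvg_cst|exact: d1].
  apply: cvgD; first by apply: cvgM; [exact: cvg_cst|exact: d2].
  by apply: cvgM; [exact: cvg_cst|exact: d3].
- move=> s _.
  have e1 : phi n s = phi n.+1 s + phi n.+1 (s + dyadic n.+1).
    by rewrite /phi [in LHS]dyS addrA; ring.
  have e2 : chi n s = chi n.+1 s + chi n.+1 (s + dyadic n.+1).
    by rewrite /chi [in LHS]dyS addrA; ring.
  have h1 := phi_le_chi n.+1 s; have h2 := phi_le_chi n.+1 (s + dyadic n.+1).
  rewrite exprS -/x in h1 h2.
  have := bellman_pt x0 (phi_ge0 n.+1 s) (phi_ge0 n.+1 (s + dyadic n.+1)) h1 h2.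
  rewrite e1 e2; move: (phi n.+1 s) (phi n.+1 (s + dyadic n.+1))
    (chi n.+1 s) (chi n.+1 (s + dyadic n.+1)) => p q P Q hh.
  apply: le_trans (_ : _ <= 12 * (P * Q)) _; last by rewrite le_eqVlt; apply/orP; left; apply/eqP; ring.
  by apply: le_trans hh; rewrite le_eqVlt; apply/orP; left; apply/eqP; ring.
Qed.

(** The square of [phi_le_chi]. It bounds each scale without making the scales summable; its use is
    to keep the potential nonnegative. *)
Let a_le_b n : 8 ^+ n * a n <= 2 ^+ n * b n.
Proof.
have -> : 8 = 2 * 2 ^+ 2 :> R by ring.
rewrite exprMn -mulrA ler_pM2l ?exprn_gt0// -riZ; last exact/itg_cont/cont_exp.
apply: ri_le.
- by apply: itgZ; exact/itg_cont/cont_exp.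
- exact/itg_cont/cont_exp.
- move=> s _; have h := phi_le_chi n s.
  have -> : (2 ^+ 2) ^+ n * phi n s ^+ 4 = (2 ^+ n * phi n s ^+ 2) ^+ 2.
    have -> : (2 ^+ 2) ^+ n = (2 ^+ n) ^+ 2 :> R by rewrite -!exprM mulnC.
    by move: (2 ^+ n : R) (phi n s) => ? ?; ring.
  by rewrite lerXn2r ?nnegrE ?mulr_ge0 ?sqr_ge0 ?exprn_ge0// (le_trans _ h)// mulr_ge0 ?sqr_ge0 ?exprn_ge0.
Qed.

(* 6 * 2^n b_n - 8^n a_n is the potential that drops by at least 8^n a_n when the
   scale is halved. *)
Lemma bellman_sum N :
  \sum_(n < N) 8 ^+ n * ri 0 1 (fun s => (G (s + dyadic n) - G s) ^+ 4) <=
  6 * ri 0 1 (fun s => (A (s + dyadic 0) - A s) ^+ 2).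
Proof.
rewrite -/(b 0%N); under eq_bigr do rewrite -/(a _).
pose P n := 6 * (2 ^+ n * b n) - 8 ^+ n * a n.
have P0 n : 0 <= P n.
  have := a_le_b n; rewrite /P; have : 0 <= 2 ^+ n * b n.
    by rewrite mulr_ge0 ?exprn_ge0// ri_ge0// => s _; exact: sqr_ge0.
  by move: (2 ^+ n * b n) (8 ^+ n * a n) => ? ? ? ?; lra.
(* This is 2^n times [bellman_step], since 8^n = 2^n (2^n)^2. *)
have step n : 8 ^+ n * a n + P n.+1 <= P n.
  have := bellman_step n; rewrite /P.
  rewrite (exprS 8 n) pow8.
  rewrite (exprS 2 n); have : 0 < 2 ^+ n :> R by rewrite exprn_gt0.
  move: (2 ^+ n : R) (a n) (a n.+1) (b n) (b n.+1) => x a0 a1 b0 b1 x0 h.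
  have {}h : x * (x ^+ 2 * (2 * a0 - 8 * a1)) <= x * (6 * b0 - 12 * b1) by rewrite ler_pM2l.
  rewrite -subr_ge0 in h; rewrite -subr_ge0.
  by apply: le_trans h _; rewrite le_eqVlt; apply/orP; left; apply/eqP; ring.
have main : \sum_(n < N) 8 ^+ n * a n + P N <= P 0%N.
  elim: N => [|N IH]; first by rewrite big_ord0 add0r.
  rewrite big_ord_recr/=; have := step N; move: IH.
  move: (\sum_(n < N) _) (8 ^+ N * a N) (P N) (P N.+1) (P 0%N).
  by move=> ? ? ? ? ? ? ?; lra.
have a0 : 0 <= a 0%N.
  by apply: ri_ge0 => s _; rewrite exprn_ge0// phi_ge0.
have := P0 N; move: main; rewrite {2}/P !expr0 !mul1r; move: a0.
move: (\sum_(n < N) _) (P N) (a 0%N) (b 0%N) => ? ? ? ? ? ? ?; lra.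
Qed.

End Bellman.

(** * Finiteness of the tangent-point energy of embedded regular W^{2,2} curves *)

Section TangentPoint.
Context {R : realType}.
Notation mu := (@lebesgue_measure R).
Notation mR := (measurableTypeR R).
Notation dyadic := (@dyadic R).

(* The integral of a nonnegative function is a supremum over simple minorants, so
   no measurability is needed. *)
Lemma ge0_le_integral_nomeas (D : set mR) (f g : mR -> \bar R) :
  (forall x, D x -> (0 <= f x)%E) -> (forall x, D x -> (f x <= g x)%E) ->
  (\int[mu]_(x in D) f x <= \int[mu]_(x in D) g x)%E.
Proof.
move=> f0 fg; rewrite !ge0_integralE//; last first.
  by move=> x Dx; exact: le_trans (f0 x Dx) (fg x Dx).
apply: ge_ereal_sup => _ [h /= hf <-]; apply: ereal_sup_ubound; exists h => //= x.
apply: le_trans (hf x) _; rewrite !patchE; case: ifPn => //.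
by rewrite inE => /fg.
Qed.

(** Reduces every admissible exponent to the critical one: below 1 the power is at most 1, above 1
    it increases with the exponent. *)
Lemma powR_le_pow4 (x q : R) : 0 <= x -> 2 < q <= 4 -> powR x q <= 1 + x ^+ 4.
Proof.
move=> x0 /andP[q2 q4]; have [x1|x1] := leP x 1.
  apply: (@le_trans _ _ 1); last by rewrite lerDl exprn_ge0.
  have -> : 1 = powR 1 q :> R by rewrite powR1.
  apply: ge0_ler_powR => //; rewrite ?nnegrE//; lra.
apply: (@le_trans _ _ (x ^+ 4)); last by rewrite lerDr.
by rewrite -(powR_mulrn 4 x0); apply: ler_powR => //; exact: ltW.
Qed.

Lemma dyadic_scale (h : R) : 0 < h -> h <= 2^-1 ->
  exists n, dyadic n.+2 < h /\ h <= dyadic n.+1.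
Proof.
move=> h0 h2; have ex : exists n, dyadic n.+2 < h.
  have /cvgrPdist_lt/(_ h h0)[N _ hN] : (fun n => (2^-1 : R) ^+ n) @ \oo --> 0.
    by apply: cvg_expr; rewrite ger0_norm ?invr_ge0// invf_lt1// ltr1n.
  exists N; have := hN N.+2 (leq_trans (leqnSn N) (leqnSn _)).
  by rewrite sub0r normrN ger0_norm// ltW// dy_gt0.
(* The least n with 2^-(n+2) < h. The upper bound is minimality, or the hypothesis h <= 1/2 when n =
   0. *)
exists (ex_minn ex); case: ex_minnP => m hm mmin; split=> //.
case: m hm mmin => [|m] hm mmin; first by rewrite /dyadic expr1.
rewrite leNgt; apply/negP => /mmin; by rewrite ltnn.
Qed.

Variable gamma : R -> V3 R.
Hypothesis hW : W22 gamma.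
Hypothesis hreg : forall t, 0 < enorm (derive1 gamma t).
Hypothesis hinj : injective_mod1 gamma.

Let T i t := derive1 gamma t 0 i.
Let g i t := d2 gamma t 0 i.
(** The l^1 norm of gamma'', which dominates each of its components. *)
Let f t := `|g (inord 0) t| + `|g (inord 1) t| + `|g (inord 2) t|.

Let pgam : periodic1 gamma. Proof. by have [] := hW. Qed.

Let L2_norm u : L2 u -> L2 (fun x => `|u x : R|).
Proof.
move=> [pu [lu lu2]]; split; first by move=> x; rewrite pu.
split; first exact: loc_norm.
by under eq_fun do rewrite real_normK ?num_real//.
Qed.

Let L2f : L2 f.
Proof.
have h i : L2 (fun x => `|g i x|) by apply: L2_norm; exact: W22_L2.
have := L2_lin 1 (L2_lin 1 (h (inord 0)) (h (inord 1))) (h (inord 2)).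
by congr L2; apply/funext => x; rewrite !mul1r.
Qed.

Let G := primitive f.
Let A := primitive (fun x => f x ^+ 2).
Let cG := ri 0 1 f.
Let cA := ri 0 1 (fun x => f x ^+ 2).

Let f0 x : 0 <= f x. Proof. by rewrite /f !addr_ge0. Qed.
Let lf : loc f := L2f.2.1.
Let lf2 : loc (fun x => f x ^+ 2) := L2f.2.2.

Let contG : continuous G. Proof. exact: prm_cont. Qed.
Let contA : continuous A. Proof. exact: prm_cont. Qed.

Let perG s : G (s + 1) = G s + cG.
Proof.
have -> : G (s + 1) = G s + (G (s + 1) - G s) by ring.
by rewrite [X in _ + X]prmB ?lerDl// ri_per//; exact: L2f.1.
Qed.

Let perA s : A (s + 1) = A s + cA.
Proof.
have -> : A (s + 1) = A s + (A (s + 1) - A s) by ring.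
by rewrite [X in _ + X]prmB ?lerDl// ri_per// => x; rewrite L2f.1.
Qed.

Let monoG s t : s <= t -> 0 <= G t - G s.
Proof. by move=> st; rewrite prmB// ri_ge0. Qed.

Let monoA s t : s <= t -> 0 <= A t - A s.
Proof. by move=> st; rewrite prmB// ri_ge0// => x _; exact: sqr_ge0. Qed.

Let GA s t : s <= t -> (G t - G s) ^+ 2 <= (t - s) * (A t - A s).
Proof.
move=> st; rewrite !prmB//; apply: ri_sqr_le => //; [exact: lf.2|exact: lf2.2].
Qed.

Let TG1 i s t : s <= t -> `|T i t - T i s| <= G t - G s.
Proof.
move=> st; have [lg ->//] := W22_prim i hW; rewrite prmB//.
have gs : itg s t (fun x => d2 gamma x 0 i) by exact: lg.2.
apply: (le_trans (ri_norm gs)); apply: ri_le.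
- exact: itg_norm.
- exact: lf.2.
- move=> x _; rewrite /f /g; case: i {lg gs} => -[|[|[|//]]] hi.
  + have -> : Ordinal hi = inord 0 by apply/val_inj; rewrite /= inordK.
    by rewrite -addrA lerDl addr_ge0.
  + have -> : Ordinal hi = inord 1 by apply/val_inj; rewrite /= inordK.
    by rewrite addrAC lerDr addr_ge0.
  + have -> : Ordinal hi = inord 2 by apply/val_inj; rewrite /= inordK.
    by rewrite lerDr addr_ge0.
Qed.

Let TG i s t : `|T i t - T i s| <= `|G t - G s|.
Proof.
have [st|ts] := leP s t; first by rewrite (ger0_norm (monoG st)) TG1.
by rewrite distrC (distrC (G t)) (ger0_norm (monoG (ltW ts))) TG1// ltW.
Qed.

Let Bd : exists2 B : R, 0 < B & forall t, 0 <= t <= 1 -> enorm (derive1 gamma t) <= B.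
Proof.
pose B0 := `|T (inord 0) 0| + `|T (inord 1) 0| + `|T (inord 2) 0| + cG + 1.
have cG0 : 0 <= cG by rewrite ri_ge0.
have B00 : 0 < B0 by rewrite /B0 ltr_wpDl// !addr_ge0.
exists (2 * B0); first by rewrite mulr_gt0.
move=> t /andP[t0 t1]; apply: enorm_le_max; first exact: ltW.
move=> i; have h1 := TG1 i t0.
have h2 : G t - G 0 <= cG.
  have := perG 0; rewrite add0r => e; have := monoG t1; rewrite e; lra.
have h3 : `|T i 0| <= `|T (inord 0) 0| + `|T (inord 1) 0| + `|T (inord 2) 0|.
  case: i {h1} => -[|[|[|//]]] hi.
  + have -> : Ordinal hi = inord 0 by apply/val_inj; rewrite /= inordK.
    by rewrite -addrA lerDl addr_ge0.
  + have -> : Ordinal hi = inord 1 by apply/val_inj; rewrite /= inordK.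
    by rewrite addrAC lerDr addr_ge0.
  + have -> : Ordinal hi = inord 2 by apply/val_inj; rewrite /= inordK.
    by rewrite lerDr addr_ge0.
have := ler_normD (T i t - T i 0) (T i 0); rewrite subrK => h4.
apply: (le_trans h4); rewrite /B0; move: h1 h2 h3.
move: `|T i t - T i 0| `|T i 0| (G t - G 0) cG (_ + _ + _) => ? ? ? ? ?.
by move=> ? ? ?; lra.
Qed.

Let cont_dot (u : R -> V3 R) : (forall i, continuous (fun t => u t 0 i)) ->
  continuous (fun t => dot3 (u t) (u t)).
Proof.
move=> cu t; rewrite /continuous_at /dot3 sum3E; under eq_fun do rewrite sum3E.
by apply: cvgD; [apply: cvgD|]; apply: cvgM; exact: cu.
Qed.

Let per_floor (F : R -> R) (P : R -> Prop) : per F ->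
  (forall t, 0 <= t <= 1 -> P (F t)) -> forall t, P (F t).
Proof.
move=> pF h t; rewrite -(per_int t (- Num.floor t) pF); apply: h.
rewrite rmorphN/= subr_ge0 floor_le lerBlDl.
by have /ltW := floorD1_gt t; rewrite intrD1.
Qed.

Let lower1 : exists2 m : R, 0 < m & forall t, m <= dot3 (derive1 gamma t) (derive1 gamma t).
Proof.
have c := cont_dot (fun i => W22_cont1 (i := i) hW).
have [t0 _ ht] := @EVT_min R _ 0 1 ler01 (continuous_subspaceT c).
exists (dot3 (derive1 gamma t0) (derive1 gamma t0)).
  by rewrite -enorm_sqr exprn_gt0.
apply: (per_floor (F := fun t => dot3 (derive1 gamma t) (derive1 gamma t))
   (P := fun y => dot3 (derive1 gamma t0) (derive1 gamma t0) <= y)).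
  by move=> t; rewrite derive1_per.
by move=> t ht1; apply: ht; rewrite in_itv.
Qed.

Let err s h := gamma (s + h) - gamma s - h *: derive1 gamma s.

Let err_le i s h : `|err s h 0 i| <= `|h| * `|G (s + h) - G s|.
Proof.
have := @taylor1 R gamma i s (s + h) `|G (s + h) - G s| hW.
have -> : s + h - s = h by ring.
rewrite /err !mxE; apply=> x /andP[x1 x2]; apply: (le_trans (TG i s x)).
have [h0|h0] := leP 0 h.
  move: x1 x2; rewrite min_l ?max_r ?lerDl// => x1 x2.
  rewrite ger0_norm ?monoG// ger0_norm ?monoG ?lerDl//.
  by have := monoG x2; lra.
have sh : s + h <= s by rewrite gerDl ltW.
move: x1 x2; rewrite min_r ?max_l// => x1 x2.
rewrite distrC (distrC (G (s + h))) ger0_norm ?monoG// ger0_norm ?monoG//.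
by have := monoG x1; lra.
Qed.

(** Short chords are nearly straight by the Taylor remainder; the others range over a compact set on
    which injectivity makes the chord length positive. Steps of size at most 1/2 represent all pairs
    of points of the circle. *)
Let biLipschitz : exists2 c : R, 0 < c & forall s h, `|h| <= 2^-1 ->
  c * h ^+ 2 <= dot3 (gamma (s + h) - gamma s) (gamma (s + h) - gamma s).
Proof.
have [m m0 hm] := lower1.
have cA0 : 0 <= cA by rewrite ri_ge0// => x _; exact: sqr_ge0.
(* By (a + b)^2 >= a^2 / 2 - b^2 the squared chord is at least m h^2 / 2 minus three squared
   remainders, each at most h^2 de cA; this de makes their sum at most m h^2 / 4. *)
pose de := Num.min 2^-1 (m / (12 * (cA + 1))).
have d0 : 0 < de.
  by rewrite lt_min invr_gt0 ltr0n divr_gt0// mulr_gt0// ltr_wpDl.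
have d2 : de <= 2^-1 by rewrite ge_min lexx.
have dm : 12 * (cA * de) <= m.
  have : de <= m / (12 * (cA + 1)) by rewrite ge_min lexx orbT.
  rewrite ler_pdivlMr; last by rewrite mulr_gt0// ltr_wpDl.
  by move=> h; nra.
have near s h : 0 <= h <= de ->
    m / 4 * h ^+ 2 <= dot3 (gamma (s + h) - gamma s) (gamma (s + h) - gamma s).
  move=> /andP[h0 hd].
  have hG : (G (s + h) - G s) ^+ 2 <= de * cA.
    have sh : s <= s + h by rewrite lerDl.
    have := GA sh; have -> : s + h - s = h by ring.
    move/le_trans; apply; apply: ler_pM => //; first exact: monoA.
    have : s + h <= s + 1 by rewrite lerD2l; apply: le_trans hd (le_trans d2 _); lra.
    by move=> /monoA; rewrite perA; lra.
  have e i : err s h 0 i ^+ 2 <= h ^+ 2 * (de * cA).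
    rewrite -real_normK ?num_real//.
    apply: (@le_trans _ _ ((`|h| * `|G (s + h) - G s|) ^+ 2)).
      by rewrite lerXn2r ?nnegrE ?mulr_ge0// err_le.
    by rewrite exprMn !real_normK ?num_real// ler_wpM2l ?sqr_ge0.
  have di i : (gamma (s + h) - gamma s) 0 i = h * T i s + err s h 0 i.
    by rewrite /err !mxE /T; ring.
  have sq (a b : R) : a ^+ 2 / 2 - b ^+ 2 <= (a + b) * (a + b).
    by have := sqr_ge0 (a + 2 * b); nra.
  have := hm s; rewrite !dot3E /Defs.comp !di -!/(T _ _) => hm'.
  have := sq (h * T (inord 0) s) (err s h 0 (inord 0)); have := e (inord 0).
  have := sq (h * T (inord 1) s) (err s h 0 (inord 1)); have := e (inord 1).
  have := sq (h * T (inord 2) s) (err s h 0 (inord 2)); have := e (inord 2).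
  rewrite !exprMn; move: (err s h 0 (inord 0)) (err s h 0 (inord 1)) (err s h 0 (inord 2)).
  move: hm'; move: (T (inord 0) s) (T (inord 1) s) (T (inord 2) s) => x y z hm' u v w.
  have hh : h ^+ 2 * m <= h ^+ 2 * (x * x + y * y + z * z) by rewrite ler_wpM2l ?sqr_ge0.
  have hd' : h ^+ 2 * (12 * (cA * de)) <= h ^+ 2 * m by rewrite ler_wpM2l ?sqr_ge0.
  move=> ? ? ? ? ? ?; lra.
have pos s h : 0 <= s <= 1 -> de <= h <= 2^-1 ->
    0 < dot3 (gamma (s + h) - gamma s) (gamma (s + h) - gamma s).
  move=> /andP[s0 s1] /andP[hd h2]; have h0 := lt_le_trans d0 hd.
  rewrite lt0r dot3_ge0 andbT; apply/negP => /eqP e.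
  have {}e : gamma (s + h) = gamma s.
    apply/eqP; rewrite -subr_eq0; apply/eqP/rowP => i; rewrite [RHS]mxE.
    apply/eqP; rewrite -sqrf_eq0 eq_le sqr_ge0 andbT -e; exact: comp_sqr_le.
  have in01 (x : R) : 0 <= x -> x <= 1 -> x \in @I01 R.
    by move=> x0 x1; rewrite inE /I01/= in_itv/= x0 x1.
  (* Injectivity concerns parameters in [0, 1], so s + h > 1 is replaced by s + h - 1 < s. *)
  have [sh|sh] := leP (s + h) 1.
    have [] : s = 0 /\ s + h = 1.
      by apply: hinj => //; [exact: in01|apply: in01 => //; lra|lra].
    by move=> ? ?; lra.
  have [] : s + h - 1 = 0 /\ s = 1.
    apply: hinj; [apply: in01; lra|exact: in01|lra|].
    by rewrite -e -[LHS]pgam subrK.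
  by move=> ? ?; lra.
pose K := `[0, 1]%classic `*` `[de, 2^-1]%classic : set (R * R).
have cK : compact K by apply: compact_setX; exact: segment_compact.
have K0 : K !=set0.
  by exists (0, 2^-1); split; rewrite /= in_itv/= ?lexx ?ler01// d2.
have cD : continuous (fun p : R * R =>
    dot3 (gamma (p.1 + p.2) - gamma p.1) (gamma (p.1 + p.2) - gamma p.1)).
  move=> p; rewrite /continuous_at /dot3 sum3E; under eq_fun do rewrite sum3E.
  have c1 : {for p, continuous (fun p : R * R => p.1 + p.2)}.
    by apply: cvgD; [exact: cvg_fst|exact: cvg_snd].
  have cc i : (fun q : R * R => (gamma (q.1 + q.2) - gamma q.1) 0 i) @ p -->
      (gamma (p.1 + p.2) - gamma p.1) 0 i.
    rewrite !mxE; under eq_fun do rewrite !mxE.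
    apply: cvgB.
      by apply: (@cvg_comp _ _ _ _ (fun x => gamma x 0 i) _ _ _ c1); exact: W22_cont.
    apply: (@cvg_comp _ _ _ _ (fun x => gamma x 0 i) _ _ _ (@cvg_fst _ _ _ _ _)).
    exact: W22_cont.
  by apply: cvgD; [apply: cvgD|]; apply: cvgM; exact: cc.
have [p Kp hp] := compact_EVT_min K0 cK (continuous_subspaceT cD).
move: Kp; rewrite inE => -[/=]; rewrite !in_itv/= => p1 p2.
set m2 := dot3 _ _ in hp; have m20 : 0 < m2 by exact: pos.
have far s h : de <= h <= 2^-1 ->
    m2 * h ^+ 2 <= dot3 (gamma (s + h) - gamma s) (gamma (s + h) - gamma s).
  move=> hh; apply: (@le_trans _ _ m2).
    rewrite ler_piMr ?(ltW m20)//; move/andP: hh => [? ?]; have := d0; nra.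
  apply: (per_floor (F := fun s => dot3 (gamma (s + h) - gamma s) (gamma (s + h) - gamma s))
    (P := fun y => m2 <= y)); first by move=> x; rewrite addrAC !pgam.
  move=> x hx; apply: (hp (x, h)); rewrite inE; split; by rewrite /= in_itv.
pose c := Num.min (m / 4) m2.
have c0 : 0 < c by rewrite lt_min m20 divr_gt0.
have main s h : 0 <= h <= 2^-1 ->
    c * h ^+ 2 <= dot3 (gamma (s + h) - gamma s) (gamma (s + h) - gamma s).
  move=> /andP[h0 h2]; have [hd|hd] := leP h de.
    apply: le_trans (near s h _); last by rewrite h0.
    by rewrite ler_wpM2r ?sqr_ge0// ge_min lexx.
  apply: le_trans (far s h _); last by rewrite h2 ltW.
  by rewrite ler_wpM2r ?sqr_ge0// ge_min lexx orbT.
exists c => // s h; have [h0 hh|h0 hh] := leP 0 h.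
  by apply: main; rewrite h0 -(ger0_norm h0).
(* A negative step h from s is the positive step - h from s + h. *)
have := main (s + h) (- h); rewrite addrK sqrrN.
rewrite (_ : dot3 (gamma s - gamma (s + h)) _ =
  dot3 (gamma (s + h) - gamma s) (gamma (s + h) - gamma s)); last first.
  by rewrite !dot3E /Defs.comp !mxE; ring.
by apply; rewrite -(ltr0_norm h0) normr_ge0.
Qed.

(** The window is symmetric about s because h may have either sign; its length is [dyadic n]. *)
Let y n s := G (s + dyadic n.+1) - G (s - dyadic n.+1).

Let y_ge0 n s : 0 <= y n s.
Proof. by apply: monoG; have := @dy_gt0 R n.+1; lra. Qed.

Let term_ge0 (c : R) n s : 0 <= c -> 0 <= c ^+ n * y n s ^+ 4.
Proof. by move=> c0; apply: mulr_ge0; exact: exprn_ge0. Qed.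

(** The tangential part of the chord d drops out, leaving 2 |err| / |d|^2 with |err| <= 2 |h| y and
    |d|^2 >= c h^2; then 1 / |h| < 4 * 2^n. Together these give 16 / c. *)
Let inv_le : exists2 K : R, 0 < K & forall s h n, dyadic n.+2 < `|h| -> `|h| <= dyadic n.+1 ->
  `|h| <= 2^-1 -> inv_rtp gamma s (s + h) <= K * (2 ^+ n * y n s).
Proof.
have [c c0 hc] := biLipschitz; exists (16 / c); first by rewrite divr_gt0.
move=> s h n h1 h2 h3; rewrite /inv_rtp; set d := gamma (s + h) - gamma s.
have K0 : 0 <= 16 / c by rewrite divr_ge0// ltW.
case: ifPn => [_|dn0]; first by apply: mulr_ge0 => //; apply: mulr_ge0 => //; exact: exprn_ge0.
set u := derive1 gamma s; set X := enorm (cross u d).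
have U0 : 0 < enorm u by exact: hreg.
have hn0 : 0 < `|h| by apply: lt_trans h1; exact: dy_gt0.
have yG : `|G (s + h) - G s| <= y n s.
  have := @dy_gt0 R n.+1; move: h2; rewrite ler_norml => /andP[hl hr] l0.
  have m1 : 0 <= G s - G (s - dyadic n.+1) by apply: monoG; rewrite gerBl ltW.
  have m2 : 0 <= G (s + dyadic n.+1) - G s by apply: monoG; rewrite lerDl ltW.
  have m3 : 0 <= G (s + dyadic n.+1) - G (s + h) by apply: monoG; rewrite lerD2l.
  have m4 : 0 <= G (s + h) - G (s - dyadic n.+1) by apply: monoG; rewrite lerD2l.
  rewrite /y ler_norml; move: m1 m2 m3 m4 => {hl hr l0}.
  move: (G (s + dyadic n.+1)) (G (s - dyadic n.+1)) (G (s + h)) (G s) => p1 p2 p3 p4.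
  by move=> ? ? ? ?; apply/andP; split; lra.
have E : enorm (err s h) <= 2 * (`|h| * y n s).
  apply: enorm_le_max; first by rewrite mulr_ge0.
  by move=> i; apply: le_trans (err_le i s h) _; rewrite ler_wpM2l.
have dE : d = h *: u + err s h by rewrite /err -/d addrCA subrr addr0.
have XE : X <= enorm u * enorm (err s h).
  rewrite -ler_sqr ?nnegrE ?mulr_ge0 ?enorm_ge0// exprMn !enorm_sqr dE.
  exact: dot3_cross_le.
have D2 : c * h ^+ 2 <= enorm d ^+ 2 by rewrite enorm_sqr; exact: hc.
have D0 : 0 < enorm d ^+ 2.
  apply: lt_le_trans D2; rewrite mulr_gt0// -real_normK ?num_real// exprn_gt0//.
have UD : 0 < enorm u * enorm d ^+ 2 by exact: mulr_gt0.
rewrite ler_pdivrMr//.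
have hh : 1 <= 4 * 2 ^+ n * `|h|.
  have := ltW h1; rewrite dyE !exprS => hd.
  have p0 : 0 < 2 * (2 * 2 ^+ n) :> R by rewrite !mulr_gt0 ?exprn_gt0.
  move: hd; rewrite -[X in X <= _]mul1r ler_pdivrMr//.
  by move/le_trans; apply; rewrite le_eqVlt; apply/orP; left; apply/eqP; ring.
apply: (@le_trans _ _ (4 * (enorm u * (`|h| * y n s)))).
  have : enorm u * enorm (err s h) <= enorm u * (2 * (`|h| * y n s)).
    by rewrite ler_wpM2l ?(ltW U0).
  move: XE; move: (enorm u * enorm (err s h)) X (enorm u) (`|h| * y n s) => ? ? ? ? ? ?.
  by lra.
apply: (@le_trans _ _ (16 / c * (2 ^+ n * y n s) * (enorm u * (c * h ^+ 2)))); last first.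
  apply: ler_wpM2l; last by apply: ler_wpM2l => //; exact: ltW.
  by apply: mulr_ge0 => //; apply: mulr_ge0 => //; exact: exprn_ge0.
have -> : 16 / c * (2 ^+ n * y n s) * (enorm u * (c * h ^+ 2)) =
  4 * (enorm u * (`|h| * y n s)) * (4 * 2 ^+ n * `|h|).
  rewrite -(real_normK (num_real h)); move: (y n s) (enorm u) `|h| (2 ^+ n) => ? ? ? ?.
  by field; rewrite gt_eqF.
apply: ler_peMr => //; apply: mulr_ge0 => //; apply: mulr_ge0; first exact: ltW.
by apply: mulr_ge0.
Qed.

(** Closeness to s is meant on the circle; for s and t in [0, 1] the translates by -1, 0 and 1
    suffice. *)
Let D n s : set mR := `[s - dyadic n.+1, s + dyadic n.+1]%classic `|`
  (`[s + 1 - dyadic n.+1, s + 1 + dyadic n.+1]%classic `|`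
   `[s - 1 - dyadic n.+1, s - 1 + dyadic n.+1]%classic).

Let mD n s : measurable (D n s).
Proof. by apply: measurableU => //; exact: measurableU. Qed.

Let mu_itv (x l : R) : 0 < l -> mu `[x - l, x + l]%classic = (2 * l)%:E.
Proof.
move=> l0; rewrite lebesgue_measure_itv/= lte_fin; case: ifPn => [_|/negP[]]; last lra.
by rewrite -EFinD; congr EFin; ring.
Qed.

Let muD n s : (mu (D n s) <= (3 * dyadic n)%:E)%E.
Proof.
have l0 := @dy_gt0 R n.+1.
apply: (@le_trans _ _ (mu `[(s - dyadic n.+1)%R, (s + dyadic n.+1)%R]%classic +
  (mu `[(s + 1 - dyadic n.+1)%R, (s + 1 + dyadic n.+1)%R]%classic +
   mu `[(s - 1 - dyadic n.+1)%R, (s - 1 + dyadic n.+1)%R]%classic))%E).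
  have U2 (P Q : set mR) : measurable P -> measurable Q ->
    (mu (P `|` Q) <= mu P + mu Q)%E by move=> ? ?; exact: measureU2.
  apply: le_trans (U2 _ _ _ _) _ => //; first exact: measurableU.
  by rewrite leeD2l//; exact: U2.
by rewrite !mu_itv// -!EFinD lee_fin (@dyS R n); lra.
Qed.

Let inv_rtp_ge0 s t : 0 <= inv_rtp gamma s t.
Proof.
rewrite /inv_rtp; case: ifP => // _.
by rewrite divr_ge0 ?mulr_ge0 ?enorm_ge0 ?exprn_ge0// enorm_ge0.
Qed.

(** One scale matches the distance of s and t, and its term alone dominates. Summing over all scales
    gives a bound measurable in t without selecting that scale. *)
Let inv4_le : exists2 K : R, 0 < K & forall s t, 0 <= s <= 1 -> 0 <= t <= 1 ->
  ((inv_rtp gamma s t ^+ 4)%:E <=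
   \sum_(n <oo) (K * (16 ^+ n * y n s ^+ 4) * \1_(D n s) t)%:E)%E.
Proof.
have [K K0 hK] := inv_le; exists (K ^+ 4); first by rewrite exprn_gt0.
move=> s t /andP[s0 s1] /andP[t0 t1].
have u0 n : (0 <= (K ^+ 4 * (16 ^+ n * y n s ^+ 4) * \1_(D n s) t)%:E)%E.
  by rewrite lee_fin; do 2 apply: mulr_ge0 => //; [apply: exprn_ge0; exact: ltW|exact: term_ge0].
(* The witness is the representative of t - s modulo 1 in [-1/2, 1/2]. *)
have [k [h2 hD hg]] : exists h : R, [/\ `|h| <= 2^-1,
    (forall n, `|h| <= dyadic n.+1 -> D n s t) & gamma (s + h) = gamma t].
  have [h1|h1] := leP (t - s) 2^-1; last first.
    exists (t - s - 1); split; first by rewrite ler_norml; apply/andP; split; lra.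
      move=> n; rewrite ler_norml => /andP[? ?]; right; left => /=.
      by rewrite in_itv/=; apply/andP; split; lra.
    by rewrite -[LHS]pgam; congr gamma; ring.
  have [h3|h3] := leP (- 2^-1) (t - s).
    exists (t - s); split; first by rewrite ler_norml h3 h1.
      move=> n; rewrite ler_norml => /andP[? ?]; left => /=.
      by rewrite in_itv/=; apply/andP; split; lra.
    by congr gamma; ring.
  exists (t - s + 1); split; first by rewrite ler_norml; apply/andP; split; lra.
    move=> n; rewrite ler_norml => /andP[? ?]; right; right => /=.
    by rewrite in_itv/=; apply/andP; split; lra.
  by rewrite -[RHS]pgam; congr gamma; ring.
have -> : inv_rtp gamma s t = inv_rtp gamma s (s + k) by rewrite /inv_rtp hg.
(* No scale matches k = 0, but there the inverse radius is 0 by convention. *)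
have [k0|kn0] := eqVneq k 0.
  by rewrite k0 addr0 /inv_rtp subrr eqxx expr0n; exact: nneseries_ge0.
have [n [n1 n2]] := @dyadic_scale `|k| ltac:(by rewrite normr_gt0) h2.
apply: (@le_trans _ _ (\sum_(0 <= i < n.+1)
    (K ^+ 4 * (16 ^+ i * y i s ^+ 4) * \1_(D i s) t)%:E)%E); last first.
  by apply: nneseries_lim_ge => i _.
rewrite big_nat_recr//=.
apply: (@le_trans _ _ (K ^+ 4 * (16 ^+ n * y n s ^+ 4) * \1_(D n s) t)%:E).
  rewrite lee_fin indicE mem_set; last exact: hD.
  have := hK s k n n1 n2 h2.
  have -> : 16 = 2 ^+ 4 :> R by ring.
  rewrite mulr1 -exprM mulnC exprM -!exprMn => hh.
  rewrite lerXn2r ?nnegrE//; apply: mulr_ge0; first exact: ltW.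
  by apply: mulr_ge0 => //; exact: exprn_ge0.
by rewrite leeDr// sume_ge0.
Qed.

Lemma TP_lty (q : R) : 2 < q <= 4 -> (TP q gamma < +oo)%E.
Proof.
move=> hq; have [K K0 hK] := inv4_le; have [B B0 hB] := Bd.
(* B^2 bounds the two speeds; the 3 comes from [muD], whose factor 2^-n also turns 16^n into 8^n. *)
pose C := 3 * (B ^+ 2 * K); have C0 : 0 <= C by rewrite mulr_ge0// mulr_ge0 ?sqr_ge0// ltW.
have B20 : (0 <= (B ^+ 2)%:E)%E by rewrite lee_fin sqr_ge0.
pose v n s := C * (8 ^+ n * y n s ^+ 4).
have v0 n s : 0 <= v n s by apply: mulr_ge0 => //; exact: term_ge0.
have inner s : 0 <= s <= 1 -> (\int[mu]_(t in `[0%R, 1%R])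
     (powR (inv_rtp gamma s t) q * enorm (derive1 gamma s)
        * enorm (derive1 gamma t))%:E <=
     (B ^+ 2)%:E + \sum_(n <oo) (v n s)%:E)%E.
  move=> hs; pose w n (t : mR) := (B ^+ 2 * (K * (16 ^+ n * y n s ^+ 4)) * \1_(D n s) t)%:E.
  have k0 n : 0 <= B ^+ 2 * (K * (16 ^+ n * y n s ^+ 4)).
    by rewrite mulr_ge0 ?sqr_ge0//; apply: mulr_ge0; [exact: ltW|exact: term_ge0].
  have w0 n t : (0 <= w n t)%E by rewrite lee_fin mulr_ge0.
  have mw n : measurable_fun (`[0, 1]%classic : set mR) (w n).
    by apply/measurable_EFinP; apply: measurable_funM.
  apply: (@le_trans _ _ (\int[mu]_(t in `[0%R, 1%R])
     ((B ^+ 2)%:E + \sum_(n <oo) w n t))%E).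
    apply: ge0_le_integral_nomeas => t; rewrite /= in_itv/= => ht.
      by rewrite lee_fin !mulr_ge0 ?powR_ge0 ?enorm_ge0.
    apply: (@le_trans _ _ ((B ^+ 2)%:E + (B ^+ 2 * inv_rtp gamma s t ^+ 4)%:E)%E).
      rewrite -EFinD lee_fin.
      have p := powR_le_pow4 (inv_rtp_ge0 s t) hq.
      have := hB s hs; have := hB t ht.
      have := enorm_ge0 (derive1 gamma s); have := enorm_ge0 (derive1 gamma t).
      have p0 := powR_ge0 (inv_rtp gamma s t) q.
      move: p p0; move: (_ `^ q) (_ ^+ 4) (enorm _) (enorm _) => P Q U V p p0 V0 U0 VB UB.
      have UV : U * V <= B ^+ 2 by rewrite expr2; apply: ler_pM.
      apply: (@le_trans _ _ (P * B ^+ 2)); first by rewrite -mulrA ler_wpM2l.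
      have : P * B ^+ 2 <= (1 + Q) * B ^+ 2 by rewrite ler_wpM2r ?sqr_ge0.
      by rewrite mulrDl mul1r mulrC (mulrC Q).
    rewrite leeD2l// EFinM; apply: (@le_trans _ _ ((B ^+ 2)%:E *
      \sum_(n <oo) (K * (16 ^+ n * y n s ^+ 4) * \1_(D n s) t)%:E)%E).
      by rewrite lee_wpmul2l ?lee_fin ?sqr_ge0// hK.
    rewrite -nneseriesZl; last first.
      move=> n _; rewrite lee_fin; do 2 apply: mulr_ge0 => //; [exact: ltW|exact: term_ge0].
    apply: lee_nneseries => n _; first by have := w0 n t; rewrite /w -!EFinM !mulrA.
    by rewrite -EFinM /w !mulrA.
  rewrite ge0_integralD//=; last 2 first.
  - by move=> t _; exact: nneseries_ge0.
  - by apply: ge0_emeasurable_sum.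
  rewrite integral_cst//= lebesgue_measure_itv/= lte_fin ltr01 sube0 mule1 leeD2l//.
  have step n : (\int[mu]_(t in `[0%R, 1%R]) w n t <= (v n s)%:E)%E; last first.
    rewrite integral_nneseries//; apply: lee_nneseries => // n _ _.
    exact: integral_ge0.
  rewrite /w; under eq_integral do rewrite EFinM.
  rewrite ge0_integralZl//; last 2 first.
  - by apply/measurable_EFinP.
  - by rewrite lee_fin.
  rewrite integral_indic//.
  apply: (@le_trans _ _ ((B ^+ 2 * (K * (16 ^+ n * y n s ^+ 4)))%:E * (3 * dyadic n)%:E)%E).
    rewrite lee_wpmul2l ?lee_fin//; apply: le_trans (muD n s).
    apply: le_measure; rewrite ?inE//; by apply: measurableI.
  rewrite -EFinM lee_fin /v /C dyE le_eqVlt; apply/orP; left; apply/eqP.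
  have -> : 16 ^+ n = 8 ^+ n * 2 ^+ n :> R by rewrite -exprMn; congr (_ ^+ n); ring.
  have : 2 ^+ n != 0 :> R by rewrite expf_neq0.
  by move: (2 ^+ n) (8 ^+ n) (y n s) => p r z p0; field.
have cy n : continuous (fun s => y n s ^+ 4).
  apply: cont_exp => x; apply: cvgB; exact: (cont_shift contG).
have cv n : continuous (v n).
  by move=> x; apply: cvgM; [exact: cvg_cst|apply: cvgM; [exact: cvg_cst|exact: cy]].
(* Translation by half a window turns the symmetric window into [s, s + dyadic n], the form that
   [bellman_sum] handles. *)
have shiftE n : ri 0 1 (fun s => y n s ^+ 4) = ri 0 1 (fun s => (G (s + dyadic n) - G s) ^+ 4).
  have -> : (fun s => y n s ^+ 4) = (fun s => (fun x => (G (x + dyadic n) - G x) ^+ 4) (s + - dyadic n.+1)).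
    apply/funext => s; rewrite /y; congr ((G _ - G _) ^+ 4).
    by rewrite (@dyS R n); ring.
  apply: ri_per_shift.
    apply: loc_cont; apply: cont_exp => x.
    by apply: cvgB; [exact: (cont_shift contG)|exact: contG].
  by move=> x; rewrite addrAC !perG; congr (_ ^+ 4); ring.
rewrite /TP; apply: (@le_lt_trans _ _ (\int[mu]_(s in `[0%R, 1%R])
  ((B ^+ 2)%:E + \sum_(n <oo) (v n s)%:E))%E).
  apply: ge0_le_integral_nomeas => s; rewrite /I01/= in_itv/= => hs; last exact: inner.
  by apply: integral_ge0 => t _; rewrite lee_fin !mulr_ge0 ?powR_ge0 ?enorm_ge0.
have mv n : measurable_fun (`[0, 1]%classic : set mR) (fun s => (v n s)%:E).
  apply/measurable_EFinP.
  exact: (measurable_funS measurableT (@subsetT _ _) (loc_cont (cv n)).1).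
have vn0 n s : (0 <= (v n s)%:E)%E by rewrite lee_fin.
rewrite ge0_integralD//=; last 2 first.
- by move=> t _; exact: nneseries_ge0.
- by apply: ge0_emeasurable_sum.
rewrite integral_cst//= lebesgue_measure_itv/= lte_fin ltr01 sube0 mule1.
rewrite integral_nneseries//.
apply: (@le_lt_trans _ _ ((B ^+ 2)%:E +
   (C * (6 * ri 0 1 (fun s => (A (s + dyadic 0) - A s) ^+ 2)))%:E)%E); last by rewrite -EFinD ltry.
rewrite leeD2l//; apply: lime_le.
  by apply: is_cvg_nneseries => n _ _; exact: integral_ge0.
apply: nearW => N.
rewrite (eq_bigr (fun n => (C * (8 ^+ n * ri 0 1 (fun s => (G (s + dyadic n) - G s) ^+ 4)))%:E)).
  rewrite sumEFin lee_fin -mulr_sumr ler_wpM2l// big_mkord.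
  exact: (bellman_sum contG contA perG perA monoG GA).
move=> n _; rewrite -itgE; last exact: itg_cont.
congr EFin; rewrite /v riZ; last by apply: itgZ; exact: itg_cont.
rewrite riZ; last exact: itg_cont.
by rewrite shiftE.
Qed.

End TangentPoint.

(** * Bending energy and lower semicontinuity *)

Section Bending.
Context {R : realType}.
Notation mu := (@lebesgue_measure R).
Notation mR := (measurableTypeR R).

(** Real-valued, being finite on W^{2,2}, and split into coordinates because the estimates on
    primitives are scalar. *)
Definition curvature_energy (gamma : R -> V3 R) : R :=
  \sum_(i < 3) ri 0 1 (fun x => d2 gamma x 0 i ^+ 2).

Lemma ae_and (P Q : R -> Prop) : {ae mu, forall x, P x} -> {ae mu, forall x, Q x} ->
  {ae mu, forall x, P x /\ Q x}.
Proof.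
have FF : Filter (almost_everywhere mu) by exact: (ae_filter_ringOfSetsType mu).
by move=> hP hQ; exact: filterI.
Qed.

(** For unit vectors a and b one has a . (b - a) = - |b - a|^2 / 2, written here for the secant (b -
    a) / m. *)
Lemma unit_secant (a0 a1 a2 b0 b1 b2 m : R) : m != 0 ->
  a0 * a0 + a1 * a1 + a2 * a2 = 1 -> b0 * b0 + b1 * b1 + b2 * b2 = 1 ->
  m * - 2^-1 * ((b0 - a0) / m * ((b0 - a0) / m) + (b1 - a1) / m * ((b1 - a1) / m) +
    (b2 - a2) / m * ((b2 - a2) / m)) =
  a0 * ((b0 - a0) / m) + a1 * ((b1 - a1) / m) + a2 * ((b2 - a2) / m).
Proof.
move=> m0 e1 e2; apply/eqP; rewrite -subr_eq0; apply/eqP.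
set l := (X in X = _).
have -> : l = (2 * m)^-1 * ((a0 * a0 + a1 * a1 + a2 * a2) -
     (b0 * b0 + b1 * b1 + b2 * b2)) by rewrite /l; field.
by rewrite e1 e2 subrr mulr0.
Qed.

(* Differentiating |gamma'|^2 = 1 at the almost every point where gamma' has
   derivative gamma''. *)
Lemma arclength_orth_ae (gamma : R -> V3 R) : W22 gamma -> arclength gamma ->
  {ae mu, forall x, 0 <= x <= 1 -> dot3 (derive1 gamma x) (d2 gamma x) = 0}.
Proof.
move=> hW al; pose P i x := 0 <= x <= 1 ->
  (fun n => (derive1 gamma (x + n.+1%:R^-1) 0 i - derive1 gamma x 0 i) / n.+1%:R^-1)
    @ \oo --> d2 gamma x 0 i.
have hP i : {ae mu, forall x, P i x} := ae_dq (W22_prim i hW).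
have := ae_and (hP (inord 0)) (ae_and (hP (inord 1)) (hP (inord 2))).
apply: filterS; first exact: (ae_filter_ringOfSetsType mu).
move=> x [p0 [p1 p2]] hx; rewrite dot3E /Defs.comp.
have {}p0 := p0 hx; have {}p1 := p1 hx; have {}p2 := p2 hx.
pose T i t := derive1 gamma t 0 i.
have unitT t : T (inord 0) t * T (inord 0) t + T (inord 1) t * T (inord 1) t +
    T (inord 2) t * T (inord 2) t = 1.
  by have := enorm_sqr (derive1 gamma t); rewrite al expr1n dot3E.
pose D i n := (T i (x + n.+1%:R^-1) - T i x) / n.+1%:R^-1.
have L1 : (fun n => T (inord 0) x * D (inord 0) n + T (inord 1) x * D (inord 1) n +
    T (inord 2) x * D (inord 2) n) @ \oo
    --> T (inord 0) x * d2 gamma x 0 (inord 0) + T (inord 1) x * d2 gamma x 0 (inord 1) +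
        T (inord 2) x * d2 gamma x 0 (inord 2).
  by apply: cvgD; [apply: cvgD|]; apply: cvgM => //; exact: cvg_cst.
(* By [unit_secant] this is the sequence of [L1] again, now with a factor 1 / (n + 1) that drives it
   to 0. *)
have L2 : (fun n => (n.+1%:R^-1 * - 2^-1) * (D (inord 0) n * D (inord 0) n +
    D (inord 1) n * D (inord 1) n + D (inord 2) n * D (inord 2) n)) @ \oo
    --> (0 * - 2^-1) * (d2 gamma x 0 (inord 0) * d2 gamma x 0 (inord 0) +
    d2 gamma x 0 (inord 1) * d2 gamma x 0 (inord 1) +
    d2 gamma x 0 (inord 2) * d2 gamma x 0 (inord 2)).
  apply: cvgM; first by apply: cvgM; [exact: cvg_harmonic|exact: cvg_cst].
  by apply: cvgD; [apply: cvgD|]; apply: cvgM.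
rewrite !mul0r in L2; apply: cvg_unique L1 _; first exact: Rhausdorff.
apply: cvg_trans L2; apply: near_eq_cvg; near=> n.
by apply: unit_secant (unitT x) (unitT _); rewrite invr_neq0.
Unshelve. all: by end_near. Qed.

(** At unit speed Lagrange's identity turns the integrand into |gamma''|^2 - (gamma' .
    gamma'')^2. *)
Lemma bending_arclength (gamma : R -> V3 R) : W22 gamma -> arclength gamma ->
  bending gamma = (curvature_energy gamma)%:E.
Proof.
move=> hW al; have hl i : L2 (fun x => d2 gamma x 0 i) by exact: W22_L2.
have mg i : measurable_fun (`[0, 1]%classic : set mR) (fun x : mR => d2 gamma x 0 i).
  exact: (measurable_funS measurableT (@subsetT _ _) (hl i).2.1.1).
have mT i : measurable_fun (`[0, 1]%classic : set mR) (fun x : mR => derive1 gamma x 0 i).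
  exact: (measurable_funS measurableT (@subsetT _ _) (loc_cont (W22_cont1 (i := i) hW)).1).
have mgg : measurable_fun (`[0, 1]%classic : set mR)
    (fun x : mR => dot3 (d2 gamma x) (d2 gamma x)).
  by apply: measurable_sum => j; exact: measurable_funM.
have mTg : measurable_fun (`[0, 1]%classic : set mR)
    (fun x : mR => dot3 (derive1 gamma x) (d2 gamma x)).
  by apply: measurable_sum => j; exact: measurable_funM.
transitivity (\int[mu]_(x in `[0%R, 1%R]) (dot3 (d2 gamma x) (d2 gamma x))%:E)%E.
  rewrite /bending; transitivity (\int[mu]_(x in `[0%R, 1%R])
    (dot3 (d2 gamma x) (d2 gamma x) - dot3 (derive1 gamma x) (d2 gamma x) ^+ 2)%:E)%E.
    apply: eq_integral => x _; congr EFin.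
    rewrite /kappa al expr1n invr1 !mulr1 enorm_sqr dot3_cross.
    by rewrite -enorm_sqr al expr1n mul1r.
  apply: ae_eq_integral => //.
  - by apply/measurable_EFinP; apply: measurable_funB => //; exact: measurable_funX.
  - exact/measurable_EFinP.
  - have := arclength_orth_ae hW al; apply: filterS; first exact: (ae_filter_ringOfSetsType mu).
    by move=> x hx; rewrite /= in_itv/= => /hx ->; rewrite expr0n subr0.
have i2 i : itg 0 1 (fun x => d2 gamma x 0 i ^+ 2) by exact: (hl i).2.2.2.
rewrite /curvature_energy sum3E -riD// -riD//; last exact: itgD.
rewrite itgE; last by apply: itgD => //; exact: itgD.
by apply: eq_integral => x _; rewrite dot3E -!expr2.
Qed.

Lemma bending_le_Etheta (q theta : R) (gamma : R -> V3 R) : 0 < theta ->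
  (bending gamma <= Etheta q theta gamma)%E.
Proof.
by move=> t0; rewrite /Etheta leeDl// mule_ge0 ?poweR_ge0// lee_fin ltW.
Qed.

Lemma ip_unif (yk : nat -> R -> R) (Y z : R -> R) : (forall k, continuous (yk k)) ->
  continuous Y -> continuous z ->
  (forall e : R, 0 < e -> \forall k \near \oo, forall t, `|yk k t - Y t| <= e) ->
  (fun k => ip (yk k) z) @ \oo --> ip Y z.
Proof.
move=> cy cY cz hu; apply/cvgrPdist_le => e e0.
pose B := ri 0 1 (fun s => `|z s|) + 1; have B0 : 0 < B by rewrite ltr_wpDl// ri_ge0.
have [N _ hN] := hu (e / B) (divr_gt0 e0 B0); exists N => // k /hN {}hN.
have i1 : itg 0 1 (fun x => Y x * z x).
  by apply: itg_cont => x; apply: cvgM; [exact: cY|exact: cz].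
have i2 : itg 0 1 (fun x => yk k x * z x).
  by apply: itg_cont => x; apply: cvgM; [exact: cy|exact: cz].
have i3 : itg 0 1 (fun x => `|z x|) by apply: itg_norm; exact: itg_cont.
rewrite /ip -riB//; apply: (le_trans (ri_norm (itgB i1 i2))).
apply: (@le_trans _ _ (e / B * ri 0 1 (fun s => `|z s|))).
  rewrite -riZ//; apply: ri_le; [by apply: itg_norm; exact: itgB|exact: itgZ|].
  by move=> x _; rewrite -mulrBl normrM ler_wpM2r// distrC.
apply: (@le_trans _ _ (e / B * B)); last by rewrite divfK// gt_eqF.
by apply: ler_wpM2l; [rewrite divr_ge0// ltW|rewrite lerDl].
Qed.

(** In T_k = W + T the term [energy h W] is nonnegative and dropped; twice the cross term is at most
    e by [ebil_bound]. *)
Lemma energy_lsc (Tk : nat -> R -> R) (T : R -> R) h : 0 < h ->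
  (forall k, continuous (Tk k)) -> continuous T ->
  (forall e : R, 0 < e -> \forall k \near \oo, forall t, `|Tk k t - T t| <= e) ->
  forall e : R, 0 < e -> \forall k \near \oo, energy h T <= energy h (Tk k) + e.
Proof.
move=> h0 ck cT hu e e0.
pose B := ri 0 1 (fun s => `|(T (s + h) - T s) / h|) + 1.
have B0 : 0 < B by rewrite ltr_wpDl// ri_ge0.
pose eta := e * h / (4 * B); have eta0 : 0 < eta by rewrite divr_gt0 ?mulr_gt0.
have [N _ hN] := hu eta eta0; exists N => // k /hN {}hN /=.
pose W t := Tk k t + -1 * T t.
have cW : continuous W.
  by move=> x; apply: cvgD; [exact: ck|apply: cvgM; [exact: cvg_cst|exact: cT]].
have Wb t : `|W t| <= eta by rewrite /W mulN1r.
have hb := ebil_bound h0 cW cT Wb.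
have -> : Tk k = (fun x => W x + 1 * T x) by apply/funext => x; rewrite /W; ring.
rewrite energy_lin// expr1n mul1r mulr1.
have hb' : `|ebil h W T| <= e / 2.
  apply: (le_trans hb); apply: (@le_trans _ _ (2 * eta / h * B)).
    apply: ler_wpM2l; last by rewrite lerDl.
    by apply: divr_ge0; [apply: mulr_ge0 => //; exact: ltW|exact: ltW].
  rewrite /eta le_eqVlt; apply/orP; left; apply/eqP; move: B B0 {hb eta eta0 hN Wb} => B B0.
  by field; rewrite !gt_eqF.
have := energy_ge0 h W; move: hb'; rewrite ler_norml.
move: (energy h W) (energy h T) (ebil h W T) => ? ? ? /andP[? ?] ?; lra.
Qed.

Lemma holder (T g : R -> R) s t : is_primitive T g -> L2 g -> s <= t -> t <= s + 1 ->
  (T t - T s) ^+ 2 <= (t - s) * ri 0 1 (fun x => g x ^+ 2).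
Proof.
move=> pT [pg [lg lg2]] st ts; apply: le_trans (prim_sqr_le pT lg2 st) _.
apply: ler_wpM2l; first by rewrite subr_ge0.
have p2 : per (fun x => g x ^+ 2) by move=> x; rewrite pg.
rewrite -(ri_per s lg2 p2) (@ri_cat _ s t (s + 1))//; last exact: lg2.2.
by rewrite lerDl ri_ge0// => x _; exact: sqr_ge0.
Qed.

End Bending.

(** * Uniform convergence from dyadic grids, and extraction of a subsequence *)

Section UniformLimit.
Context {R : realType}.
Notation dyadic := (@dyadic R).

(** Compare t, reduced modulo 1, with the dyadic point on its left: the common 1/2-Hölder modulus
    bounds both displacements and the grid bounds the difference there, each by e / 3. *)
Lemma grid_uniform (y : nat -> R -> R) (Y : R -> R) (C : R) : 0 <= C ->
  (forall k, per (y k)) -> per Y ->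
  (forall k s t, s <= t -> t <= s + 1 -> (y k t - y k s) ^+ 2 <= C * (t - s)) ->
  (forall s t, s <= t -> t <= s + 1 -> (Y t - Y s) ^+ 2 <= C * (t - s)) ->
  (forall k (a : nat), (a <= 2 ^ k)%N ->
     `|y k (a%:R * dyadic k) - Y (a%:R * dyadic k)| <= k.+1%:R^-1) ->
  forall e : R, 0 < e -> \forall k \near \oo, forall t, `|y k t - Y t| <= e.
Proof.
move=> C0 py pY hy hY grid e e0.
have e30 : 0 < e / 3 by rewrite divr_gt0.
have k1 : \forall k \near \oo, (k.+1%:R^-1 : R) <= e / 3.
  have /cvgrPdist_le/(_ _ e30) := @cvg_harmonic R; apply: filterS => k.
  by rewrite sub0r normrN ger0_norm// invr_ge0.
have k2 : \forall k \near \oo, C * dyadic k <= (e / 3) ^+ 2.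
  have hc : (fun k => C * dyadic k) @ \oo --> C * 0.
    apply: cvgM; first exact: cvg_cst.
    by apply: cvg_expr; rewrite ger0_norm ?invr_ge0// invf_lt1// ltr1n.
  have e9 : 0 < (e / 3) ^+ 2 by rewrite exprn_gt0.
  move/cvgrPdist_le: hc => /(_ _ e9); apply: filterS => k.
  rewrite mulr0 sub0r normrN ger0_norm// mulr_ge0//; exact/ltW/dy_gt0.
have [N1 _ H1] := k1; have [N2 _ H2] := k2; exists (maxn N1 N2) => // k.
rewrite /= geq_max => /andP[/H1 h1 /H2 h2] t.
have sq (x : R) : x ^+ 2 <= C * dyadic k -> `|x| <= e / 3.
  move=> hx; rewrite -ler_sqr ?nnegrE ?(ltW e30)// real_normK ?num_real//.
  exact: le_trans hx h2.
pose r := t - (Num.floor t)%:~R.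
have -> : y k t = y k r by rewrite /r -rmorphN/= per_int.
have -> : Y t = Y r by rewrite /r -rmorphN/= per_int.
have r0 : 0 <= r by rewrite subr_ge0 floor_le.
have r1 : r <= 1.
  by rewrite lerBlDl; have /ltW := floorD1_gt t; rewrite intrD1.
have p0 : 0 < 2 ^+ k :> R by rewrite exprn_gt0.
pose a := Num.trunc (r * 2 ^+ k).
have rk0 : 0 <= r * 2 ^+ k by rewrite mulr_ge0// ltW.
have a1 : a%:R * dyadic k <= r by rewrite dyE ler_pdivrMr// truncn_le.
have a2 : r - a%:R * dyadic k <= dyadic k.
  have -> : r - a%:R * dyadic k <= dyadic k = (r * 2 ^+ k <= a.+1%:R).
    by rewrite lerBlDl -{2}[dyadic k]mul1r -mulrDl natr1 dyE ler_pdivlMr.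
  by apply: ltW; exact: truncnS_gt.
have ak : (a <= 2 ^ k)%N.
  rewrite -(@ler_nat R) natrX; apply: (@le_trans _ _ (r * 2 ^+ k)); first by rewrite truncn_le.
  by rewrite ler_piMl// ltW.
have dk1 : dyadic k <= 1 by rewrite /dyadic exprn_ile1// ?invr_ge0// invf_le1// ler1n.
have ra : r <= a%:R * dyadic k + 1 by lra.
have m : C * (r - a%:R * dyadic k) <= C * dyadic k by rewrite ler_wpM2l.
have q1 := sq _ (le_trans (hy k _ _ a1 ra) m).
have q2 := sq _ (le_trans (hY _ _ a1 ra) m).
have q3 := le_trans (grid k a ak) h1.
have -> : y k r - Y r = (y k r - y k (a%:R * dyadic k)) +
   ((y k (a%:R * dyadic k) - Y (a%:R * dyadic k)) - (Y r - Y (a%:R * dyadic k))) by ring.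
apply: le_trans (ler_normD _ _) _; apply: le_trans (lerD q1 (ler_normB _ _)) _.
by have := lerD q3 q2; lra.
Qed.

(** Members of U meet every tail of the integers because U refines the filter at infinity, so each
    index can be chosen beyond the previous one. *)
Lemma subsequence_of_ultra (U : set_system nat) (P : nat -> nat -> Prop) :
  UltraFilter U -> \oo `<=` U -> (forall k, U (P k)) ->
  exists phi : nat -> nat, (forall k, (phi k < phi k.+1)%N) /\ forall k, P k (phi k).
Proof.
move=> UF sU hP; have PF : ProperFilter U by exact: ultra_proper.
have ex k N : exists j, (N < j)%N /\ P k j.
  have hN : U [set j | (N < j)%N] by apply: sU; exists N.+1.
  by have [j [? ?]] := filter_ex (filterI hN (hP k)); exists j.
have /choice[F hF] : forall p : nat * nat, exists j, (p.2 < j)%N /\ P p.1 j.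
  by move=> [k N]; exact: ex.
pose phi := fix phi k := if k is m.+1 then F (m.+1, phi m) else F (0%N, 0%N).
exists phi; split=> [k|[|k]]; rewrite /=.
- exact: (hF (k.+1, phi k)).1.
- exact: (hF (0%N, 0%N)).2.
- exact: (hF (k.+1, phi k)).2.
Qed.

End UniformLimit.

(** * Periodic primitives, a priori bounds and differentiability of limits *)

Section Compactness.
Context {R : realType}.
Notation mu := (@lebesgue_measure R).
Notation mR := (measurableTypeR R).
Notation dyadic := (@dyadic R).

(** The right endpoint is null. It is excluded because a periodic extension takes there its value at
    the left endpoint. *)
Lemma ri_eq_co a b (f g : R -> R) : itg a b f -> itg a b g ->
  (forall x, a <= x < b -> f x = g x) -> ri a b f = ri a b g.
Proof.
move=> hf hg fg; have sub (u : R -> R) : itg a b u ->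
    mu.-integrable `[a, b[%classic (EFin \o u).
  by apply: integrableS => //; apply: subset_itv; rewrite bnd_simp.
rewrite !riE -!Rintegral_itv_bndo_bndc; [|exact: sub|exact: sub].
by apply: eq_Rintegral => x; rewrite inE/= in_itv/=; exact: fg.
Qed.

Lemma floorS (x : R) : Num.floor (x + 1) = Num.floor x + 1.
Proof.
apply: floor_def; have /andP[h1 h2] := floor_itv x.
by rewrite !intrD lerD2r h1 ltrD2r -intrD.
Qed.

(** g is g0 composed with the fractional part. It integrates to T 1 - T 0 = 0 over a period, so T -
    T 0 minus the primitive of g is periodic; it vanishes on [0, 1], hence everywhere. *)
Lemma prim_extend (T g0 : R -> R) : per T -> itg 0 1 g0 ->
  (forall s t, 0 <= s -> s <= t -> t <= 1 -> T t - T s = ri s t g0) ->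
  exists2 g, per g & is_primitive T g.
Proof.
move=> pT h0 hT; pose g x := g0 (x - (Num.floor x)%:~R).
have pg : per g by move=> x; rewrite /g floorS intrD; congr g0; ring.
have gE x : 0 <= x < 1 -> g x = g0 x.
  move=> hx; have f0 : Num.floor x = 0 by apply: floor_def; rewrite add0r.
  by rewrite /g f0 subr0.
have ms : measurable_fun (`[0, 1[%classic : set mR) (g0 : mR -> R).
  apply: (measurable_funS (measurable_itv `[0, 1]) _ (itg_meas h0)).
  by apply: subset_itv; rewrite bnd_simp.
have mg' : measurable_fun (`[0, 1[%classic : set mR) (g : mR -> R).
  apply: (eq_measurable_fun g0) ms => x; rewrite inE/= in_itv/= => hx.
  by rewrite gE.
have mg : mf `[0, 1]%classic g by exact/measurable_fun_itv_bndo_bndcP.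
have hg : itg 0 1 g.
  apply/integrableP; split; first exact/measurable_EFinP.
  have /integrableP[m1 h1] := h0.
  rewrite -integral_itv_bndo_bndc; last first.
    by apply: measurableT_comp => //; exact/measurable_EFinP.
  apply: le_lt_trans h1; rewrite -[leRHS]integral_itv_bndo_bndc; last first.
    by apply: measurableT_comp => //; exact/measurable_EFinP.
  rewrite le_eqVlt; apply/orP; left; apply/eqP.
  by apply: eq_integral => x; rewrite inE/= in_itv/= => /gE ->.
have lg := loc_per pg hg; exists g => //; split=> // s t st.
have key u : T u = T 0 + primitive g u.
  have h01 v : 0 <= v <= 1 -> T v - (T 0 + primitive g v) = 0.
    move=> /andP[v0 v1]; rewrite /primitive v0 (@ri_eq_co 0 v g g0).
    - by rewrite -hT// (addrC (T 0)) subrK subrr.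
    - exact: lg.2.
    - exact: itgS h0.
    - move=> x /andP[x0 xv]; apply: gE; rewrite x0/=; exact: lt_le_trans xv v1.
  have T10 : T 1 = T 0 by rewrite -[RHS]pT add0r.
  have pH : per (fun v => T v - (T 0 + primitive g v)).
    move=> v; rewrite pT; congr (_ - (_ + _)).
    have : primitive g (v + 1) - primitive g v = 0.
      rewrite prmB ?lerDl// ri_per//.
      have := h01 1; rewrite ler01 lexx => /(_ isT); rewrite T10 /primitive ler01.
      by move: (T 0) (ri 0 1 g) => ? ? ?; lra.
    by move/eqP; rewrite subr_eq0 => /eqP.
  apply/eqP; rewrite -subr_eq0; apply/eqP.
  have := per_int u (- Num.floor u) pH => <-; apply: h01.
  rewrite rmorphN/= subr_ge0 floor_le lerBlDl.
  by have /ltW := floorD1_gt u; rewrite intrD1.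
by rewrite (key t) (key s) -prmB// opprD addrACA subrr add0r.
Qed.

Lemma arclength_le1 (gamma : R -> V3 R) i t : arclength gamma ->
  `|derive1 gamma t 0 i| <= 1.
Proof. by move=> al; rewrite -(al t) comp_le_enorm. Qed.

(** The constant 3 is 1 for the speed plus 2 for the oscillation of a unit tangent in [taylor1]. *)
Lemma arclength_lip (gamma : R -> V3 R) i s t : W22 gamma -> arclength gamma ->
  `|gamma t 0 i - gamma s 0 i| <= 3 * `|t - s|.
Proof.
move=> hW al; have := @taylor1 R gamma i s t 2 hW.
move=> /(_ _)/wrap[x _|h].
  apply: le_trans (ler_normB _ _) _.
  by have := arclength_le1 i x al; have := arclength_le1 i s al; lra.
have -> : gamma t 0 i - gamma s 0 i = (gamma t 0 i - gamma s 0 i -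
  (t - s) * derive1 gamma s 0 i) + (t - s) * derive1 gamma s 0 i by ring.
apply: le_trans (ler_normD _ _) _; rewrite [X in _ + X]normrM.
have : `|t - s| * `|derive1 gamma s 0 i| <= `|t - s| * 1.
  by rewrite ler_wpM2l// arclength_le1.
by lra.
Qed.

(** The maps t -> - t and t -> - t + 1/2 fix 0 and 1/4. At 0 the third rotation kills the first two
    coordinates, at 1/4 the first rotation kills the last one. So each coordinate has a zero within
    distance 1 of any reduced parameter. *)
Lemma D2sym_bound (gamma : R -> V3 R) i t : W22 gamma -> arclength gamma ->
  D2sym gamma -> `|gamma t 0 i| <= 3.
Proof.
move=> hW al [_ [pg [_ [R1 [_ R3]]]]].
have z0 (x : R) : -1 * x = x -> x = 0 by move=> h; lra.
have [s s01 hs] : exists2 s : R, 0 <= s <= 1 & gamma s 0 i = 0.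
  case: i => -[|[|[|//]]] hi.
  - exists 0; first by rewrite lexx ler01.
    by apply: z0; have := congr1 (fun v : V3 R => v 0 (Ordinal hi)) (R3 0); rewrite oppr0 mxE.
  - exists 0; first by rewrite lexx ler01.
    by apply: z0; have := congr1 (fun v : V3 R => v 0 (Ordinal hi)) (R3 0); rewrite oppr0 mxE.
  - exists 4^-1; first by apply/andP; split; lra.
    apply: z0; have := congr1 (fun v : V3 R => v 0 (Ordinal hi)) (R1 4^-1).
    by have -> : - 4^-1 + 1 / 2 = 4^-1 :> R by [field]; rewrite mxE.
have pc : per (fun t => gamma t 0 i) by move=> x; rewrite pg.
rewrite -(per_int t (- Num.floor t) pc) rmorphN/=.
set r := t - _; have r0 : 0 <= r by rewrite subr_ge0 floor_le.
have r1 : r <= 1 by rewrite lerBlDl; have /ltW := floorD1_gt t; rewrite intrD1.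
have := arclength_lip i s r hW al; rewrite hs subr0 => h; apply: le_trans h _.
have : `|r - s| <= 1 by move/andP: s01 => [? ?]; rewrite ler_norml; apply/andP; split; lra.
by lra.
Qed.

Lemma cvg_eq_ultra (U : set_system nat) (x : nat -> R) (l l' : R) : UltraFilter U ->
  x @ U --> l -> x @ U --> l' -> l = l'.
Proof.
move=> UF h h'; have PF : ProperFilter U by exact: ultra_proper.
exact: cvg_unique h h'.
Qed.

(** [taylor1] with the 1/2-Hölder modulus of the tangent. Only values of the curve and its
    derivative enter, so the bound survives pointwise limits and feeds [derive_of_remainder]. *)
Lemma curve_taylor (gamma : R -> V3 R) i t h M : W22 gamma ->
  ri 0 1 (fun x => d2 gamma x 0 i ^+ 2) <= M -> `|h| <= 1 ->
  (gamma (t + h) 0 i - gamma t 0 i - h * derive1 gamma t 0 i) ^+ 2 <= h ^+ 2 * (M * `|h|).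
Proof.
move=> hW hM h1; have hp := W22_prim i hW; have hl := W22_L2 i hW.
have M0 : 0 <= M by apply: le_trans hM; apply: ri_ge0 => x _; exact: sqr_ge0.
have := @taylor1 R gamma i t (t + h) (Num.sqrt (M * `|h|)) hW.
have -> : t + h - t = h by ring.
move=> /(_ _)/wrap[x /andP[x1 x2]|H].
  rewrite -sqrtr_sqr ler_wsqrtr//.
  have [tx|xt] := leP t x.
    have xh : x - t <= `|h|.
      have [h0|h0] := leP 0 h.
        by move: x2; rewrite max_r ?lerDl// (ger0_norm h0) lerBlDl.
      have : x <= t by move: x2; rewrite max_l// gerDl ltW.
      by move=> ?; have := normr_ge0 h; lra.
    have := holder hp hl tx; rewrite -lerBlDl => /(_ (le_trans xh h1)) H.
    apply: (le_trans H); rewrite mulrC; apply: ler_pM => //; last by rewrite subr_ge0.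
    by apply: ri_ge0 => y _; exact: sqr_ge0.
  have xh : t - x <= `|h|.
    have [h0|h0] := leP 0 h.
      have : t <= x by move: x1; rewrite min_l// lerDl.
      by move=> ?; have := normr_ge0 h; lra.
    by move: x1; rewrite min_r ?gerDl ?(ltW h0)// (ltr0_norm h0); lra.
  have := holder hp hl (ltW xt); rewrite -lerBlDl => /(_ (le_trans xh h1)) H.
  rewrite -sqrrN opprB; apply: (le_trans H); rewrite mulrC; apply: ler_pM => //.
    by apply: ri_ge0 => y _; exact: sqr_ge0.
  by rewrite subr_ge0 ltW.
rewrite -real_normK ?num_real//.
apply: (@le_trans _ _ ((`|h| * Num.sqrt (M * `|h|)) ^+ 2)).
  by rewrite lerXn2r ?nnegrE ?mulr_ge0 ?sqrtr_ge0.
by rewrite exprMn real_normK ?num_real// sqr_sqrtr// mulr_ge0.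
Qed.

Lemma derive_of_remainder (f : R -> R) (t d M : R) : 0 <= M ->
  (forall h, `|h| <= 1 -> (f (t + h) - f t - h * d) ^+ 2 <= h ^+ 2 * (M * `|h|)) ->
  derivable f t 1 /\ derive1 f t = d.
Proof.
move=> M0 H.
have hc : (fun h => h^-1 *: ((f \o shift t) (h *: 1) - f t)) @ 0^' --> d.
  apply/cvgrPdist_le => e e0; near=> h.
  have hn0 : h != 0 by near: h; exact: nbhs_dnbhs_neq.
  have h1 : `|h| <= 1 by near: h; apply: dnbhs0_le.
  have h2 : `|h| <= e ^+ 2 / (M + 1).
    by near: h; apply: dnbhs0_le; rewrite divr_gt0 ?exprn_gt0// ltr_wpDl.
  rewrite /= /GRing.scale/= mulr1 addrC (addrC h).
  rewrite -ler_sqr ?nnegrE ?(ltW e0)// real_normK ?num_real//.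
  have hh : 0 < h ^+ 2 by rewrite exprn_even_gt0.
  rewrite -(ler_pM2l hh) -exprMn.
  have -> : h * (- (h^-1 * (f (t + h) - f t)) + d) = - (f (t + h) - f t - h * d).
    by move: (f (t + h)) (f t) => ? ?; field.
  rewrite sqrrN; apply: le_trans (H h h1) _.
  apply: ler_wpM2l; first exact: sqr_ge0.
  move: h2; rewrite ler_pdivlMr ?ltr_wpDl// => h2; apply: le_trans h2.
  by rewrite mulrC ler_wpM2l// lerDl.
split; first by apply/cvg_ex; exists d.
by rewrite derive1E; apply: cvg_lim => //; exact: Rhausdorff.
Unshelve. all: by end_near. Qed.

End Compactness.

(** * Construction of the limit curve *)

Section Limit.
Context {R : realType}.
Notation mu := (@lebesgue_measure R).
Notation mR := (measurableTypeR R).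
Notation dyadic := (@dyadic R).

Variables (Gamma : nat -> R -> V3 R) (M : R).
Hypothesis hW : forall j, W22 (Gamma j).
Hypothesis hal : forall j, arclength (Gamma j).
Hypothesis hD : forall j, D2sym (Gamma j).
Hypothesis hM : forall j, curvature_energy (Gamma j) <= M.

Let T j i t := derive1 (Gamma j) t 0 i.
Let g j i t := d2 (Gamma j) t 0 i.

Let gM j i : ri 0 1 (fun x => g j i x ^+ 2) <= M.
Proof.
apply: le_trans (hM j); rewrite /curvature_energy (bigD1 i)//= lerDl.
by apply: sumr_ge0 => k _; apply: ri_ge0 => x _; exact: sqr_ge0.
Qed.

Let M0 : 0 <= M.
Proof. by apply: le_trans (gM 0 0); apply: ri_ge0 => x _; exact: sqr_ge0. Qed.

Let pT j i : is_primitive (T j i) (g j i). Proof. exact: W22_prim. Qed.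
Let lg j i : L2 (g j i). Proof. exact: W22_L2. Qed.
Let perGam j : periodic1 (Gamma j). Proof. by have [] := hW j. Qed.

(** M serves the tangents; 9 = 3^2 serves the curves, whose squared increments 9 (t - s)^2 are at
    most 9 (t - s) over lengths up to 1. *)
Let C := M + 9.
Let C0 : 0 <= C. Proof. by rewrite /C addr_ge0. Qed.

Let modT j i s t : s <= t -> t <= s + 1 -> (T j i t - T j i s) ^+ 2 <= C * (t - s).
Proof.
move=> st ts; apply: (le_trans (holder (pT j i) (lg j i) st ts)); rewrite mulrC.
apply: ler_wpM2r; first by rewrite subr_ge0.
by apply: le_trans (gM j i) _; rewrite /C lerDl.
Qed.

Let modG j i s t : s <= t -> t <= s + 1 ->
  (Gamma j t 0 i - Gamma j s 0 i) ^+ 2 <= C * (t - s).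
Proof.
move=> st ts; have := arclength_lip i s t (hW j) (hal j).
rewrite (ger0_norm (_ : 0 <= t - s)) ?subr_ge0// => h.
rewrite -real_normK ?num_real//; apply: (@le_trans _ _ ((3 * (t - s)) ^+ 2)).
  by rewrite lerXn2r ?nnegrE ?mulr_ge0 ?subr_ge0.
have d0 : 0 <= t - s by rewrite subr_ge0.
have d1 : t - s <= 1 by rewrite lerBlDl.
have : (t - s) * (t - s) <= 1 * (t - s) by rewrite ler_wpM2r.
have : 0 <= M * (t - s) by rewrite mulr_ge0.
rewrite /C; move: (t - s) M => d m; rewrite exprMn; nra.
Qed.

Lemma compactness : exists (Gamma0 : R -> V3 R) (phi : nat -> nat),
  W22 Gamma0 /\ arclength Gamma0 /\ D2sym Gamma0 /\
  (forall k, (phi k < phi k.+1)%N) /\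
  (forall i (e : R), 0 < e -> \forall k \near \oo, forall t,
     `|Gamma (phi k) t 0 i - Gamma0 t 0 i| <= e) /\
  (forall i (e : R), 0 < e -> \forall k \near \oo, forall t,
     `|derive1 (Gamma (phi k)) t 0 i - derive1 Gamma0 t 0 i| <= e).
Proof.
have [U [UF sU]] := ultraFilterLemma (F := (\oo : set_system nat)) _.
have PF : ProperFilter U by exact: ultra_proper.
have /choice[X' hX'] : forall p : 'I_3 * R, exists l : R,
    (fun j => Gamma j p.2 0 p.1) @ U --> l.
  by move=> p; apply: (@ultra_lim R U _ 3 UF) => j; exact: D2sym_bound.
have /choice[Y' hY'] : forall p : 'I_3 * R, exists l : R,
    (fun j => T j p.1 p.2) @ U --> l.
  by move=> p; apply: (@ultra_lim R U _ 1 UF) => j; exact: arclength_le1.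
pose X i t := X' (i, t); pose Y i t := Y' (i, t).
have hX i t : (fun j => Gamma j t 0 i) @ U --> X i t by exact: (hX' (i, t)).
have hY i t : (fun j => T j i t) @ U --> Y i t by exact: (hY' (i, t)).
have perX i : per (X i).
  move=> t; apply: (cvg_eq_ultra UF (hX i (t + 1))).
  by under eq_fun do rewrite perGam; exact: hX.
have perY i : per (Y i).
  move=> t; apply: (cvg_eq_ultra UF (hY i (t + 1))).
  have -> : (fun j => T j i (t + 1)) = (fun j => T j i t); last exact: hY.
  by apply/funext => j; rewrite /T derive1_per.
have modX i s t : s <= t -> t <= s + 1 -> (X i t - X i s) ^+ 2 <= C * (t - s).
  move=> st ts; rewrite expr2.
  apply: (ultra_le (x := fun j => (Gamma j t 0 i - Gamma j s 0 i) *
    (Gamma j t 0 i - Gamma j s 0 i)) UF).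
    by move=> j; rewrite -expr2 modG.
  by apply: cvgM; apply: cvgB.
have modY i s t : s <= t -> t <= s + 1 -> (Y i t - Y i s) ^+ 2 <= C * (t - s).
  move=> st ts; rewrite expr2.
  apply: (ultra_le (x := fun j => (T j i t - T j i s) * (T j i t - T j i s)) UF).
    by move=> j; rewrite -expr2 modT.
  by apply: cvgM; apply: cvgB.
(* The remainder estimate passes to the ultralimit, so the limit of the tangents is the derivative
   of the limit curve before any uniform convergence is known. *)
have dX i t : derivable (X i) t 1 /\ derive1 (X i) t = Y i t.
  apply: (@derive_of_remainder R _ _ _ M M0) => h h1; rewrite expr2.
  apply: (ultra_le (x := fun j => (Gamma j (t + h) 0 i - Gamma j t 0 i - h * T j i t) *
    (Gamma j (t + h) 0 i - Gamma j t 0 i - h * T j i t)) UF).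
    by move=> j; rewrite -expr2; apply: curve_taylor => //; exact: gM.
  by apply: cvgM; apply: cvgB; [exact: cvgB|apply: cvgM; [exact: cvg_cst|exact: hY]|
    exact: cvgB|apply: cvgM; [exact: cvg_cst|exact: hY]].
(* Three coordinates at 2^k + 1 grid points make finitely many conditions, so their conjunction
   belongs to U. *)
pose P k j := forall q : 'I_3 * 'I_(2 ^ k).+1,
  `|Gamma j (q.2%:R * dyadic k) 0 q.1 - X q.1 (q.2%:R * dyadic k)| <= k.+1%:R^-1 /\
  `|T j q.1 (q.2%:R * dyadic k) - Y q.1 (q.2%:R * dyadic k)| <= k.+1%:R^-1.
have hP k : U (P k).
  have k0 : 0 < k.+1%:R^-1 :> R by rewrite invr_gt0.
  apply: filter_forall => q; apply: filterI.
  - have /cvgrPdist_le/(_ _ k0) := hX q.1 (q.2%:R * dyadic k); apply: filterS => j.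
    by rewrite distrC.
  - have /cvgrPdist_le/(_ _ k0) := hY q.1 (q.2%:R * dyadic k); apply: filterS => j.
    by rewrite distrC.
have [phi [phi_inc hphi]] := subsequence_of_ultra UF sU hP.
have ordk k a : (a <= 2 ^ k)%N -> exists o : 'I_(2 ^ k).+1, a = o :> nat.
  by rewrite -ltnS => ak; exists (Ordinal ak).
have cvX i (e : R) : 0 < e -> \forall k \near \oo, forall t,
    `|Gamma (phi k) t 0 i - X i t| <= e.
  apply: (@grid_uniform R (fun k t => Gamma (phi k) t 0 i) (X i) C C0) => //.
  - by move=> k t; rewrite perGam.
  - by move=> k s t; exact: modG.
  - by move=> s t; exact: modX.
  - by move=> k a /ordk[m ->]; have [] := hphi k (i, m).
have cvY i (e : R) : 0 < e -> \forall k \near \oo, forall t,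
    `|T (phi k) i t - Y i t| <= e.
  apply: (@grid_uniform R (fun k t => T (phi k) i t) (Y i) C C0) => //.
  - by move=> k t; rewrite /T derive1_per.
  - by move=> k s t; exact: modT.
  - by move=> s t; exact: modY.
  - by move=> k a /ordk[m ->]; have [] := hphi k (i, m).
(* Both sides of T t - T s = \int_s^t g converge along U, which makes the weak density a derivative
   of [Y i] on [0, 1]; it is then extended periodically. *)
have /choice[h Hh] : forall i, exists h : R -> R, per h /\ is_primitive (Y i) h.
  move=> i.
  have [g0 [ig0 hg0]] := @weak_limit R U (fun j => g j i) M UF
    (fun j => (lg j i).2.1.2 0 1) (fun j => (lg j i).2.2.2 0 1) (fun j => gM j i).
  have [|h ph hh] := @prim_extend R (Y i) g0 (perY i) ig0; last by exists h.
  move=> s t s0 st t1; apply: (cvg_eq_ultra UF _ (hg0 s t s0 st t1)).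
  have -> : (fun j => ri s t (g j i)) = (fun j => T j i t - T j i s).
    by apply/funext => j; rewrite (pT j i).2.
  exact: cvgB.
have contY i : continuous (Y i) := prim_cont (Hh i).2.
(* At each fixed scale the bound M is inherited by lower semicontinuity along the subsequence. *)
have EY i n : energy n.+1%:R^-1 (Y i) <= M.
  have n0 : 0 < n.+1%:R^-1 :> R by rewrite invr_gt0.
  have n1 : n.+1%:R^-1 <= 1 :> R by rewrite invf_le1// ler1n.
  rewrite leNgt; apply/negP => hlt.
  have e0 : 0 < (energy n.+1%:R^-1 (Y i) - M) / 2 by rewrite divr_gt0// subr_gt0.
  have [N _ hN] := energy_lsc n0 (fun k => prim_cont (pT (phi k) i)) (contY i) (cvY i) e0.
  have := hN N (leqnn N) => /=.
  have := energy_le (pT (phi N) i) (lg (phi N) i).1 (lg (phi N) i).2.2 (_ : 0 < n.+1%:R^-1 <= 1).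
  rewrite n0 n1 => /(_ isT) h1 h2; have h3 := gM (phi N) i.
  have arith (x y z w : R) : y <= z -> x <= y + (x - w) / 2 -> z <= w -> w < x -> False.
    by move=> ? ? ? ?; lra.
  exact: arith h1 h2 h3 hlt.
(* If the integral of h_i^2 exceeded M, so would some energy, by [energy_liminf]. *)
have ih2 i : itg 0 1 (fun x => h i x ^+ 2).
  have [[mh _] _] := (Hh i).2.
  have m2 : measurable_fun (`[0, 1]%classic : set mR) (fun x : mR => h i x ^+ 2).
    by apply: measurable_funX; exact: (measurable_funS measurableT (@subsetT _ _) mh).
  apply/integrableP; split; first exact/measurable_EFinP.
  under eq_integral do rewrite /= ger0_norm ?sqr_ge0//.
  apply: (@le_lt_trans _ _ M%:E); last by rewrite ltry.
  rewrite leNgt; apply/negP => hlt.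
  have [N _ hN] := energy_liminf (Hh i).2 hlt.
  by have := hN N (leqnn N); rewrite /= ltNge EY.
pose Gamma0 t : V3 R := \row_(i < 3) X i t.
have comp0 i : (fun t => Gamma0 t 0 i) = X i by apply/funext => t; rewrite mxE.
have dG0 t : derivable Gamma0 t 1.
  apply/derivable_mxP => i j; rewrite ord1.
  by have -> : (fun x => Gamma0 x 0 j) = X j by [exact: comp0]; exact: (dX j t).1.
have derG0 t i : derive1 Gamma0 t 0 i = Y i t.
  by rewrite derive1_comp// comp0 (dX i t).2.
have perG0 : periodic1 Gamma0 by move=> t; apply/rowP => i; rewrite !mxE perX.
have alG0 : arclength Gamma0.
  move=> t; rewrite /enorm dot3E /Defs.comp !derG0.
  have -> : Y (inord 0) t * Y (inord 0) t + Y (inord 1) t * Y (inord 1) t +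
     Y (inord 2) t * Y (inord 2) t = 1; last by rewrite sqrtr1.
  apply: (@cvg_eq_ultra R U (fun j => T j (inord 0) t * T j (inord 0) t +
    T j (inord 1) t * T j (inord 1) t + T j (inord 2) t * T j (inord 2) t) _ _ UF).
    by apply: cvgD; [apply: cvgD|]; apply: cvgM.
  have -> : (fun j => T j (inord 0) t * T j (inord 0) t + T j (inord 1) t * T j (inord 1) t +
    T j (inord 2) t * T j (inord 2) t) = (fun=> 1); last exact: cvg_cst.
  by apply/funext => j; have := enorm_sqr (derive1 (Gamma j) t); rewrite hal expr1n dot3E.
have W0 : W22 Gamma0.
  split=> //; split=> //; exists (fun x => \row_(i < 3) h i x); split.
    by move=> x; apply/rowP => i; rewrite !mxE (Hh i).1.
  split.
    move=> i; under eq_fun do rewrite mxE.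
    exact: (measurable_funS measurableT (@subsetT _ _) (Hh i).2.1.1).
  split.
    have iS : itg 0 1 (fun x => h (inord 0) x ^+ 2 + h (inord 1) x ^+ 2 + h (inord 2) x ^+ 2).
      by apply: itgD => //; exact: itgD.
    have /integrable_lty := iS; move=> /(_ (measurable_itv _)).
    congr (_ < _)%E; apply: eq_integral => x _ /=; congr EFin.
    by rewrite enorm_sqr dot3E /Defs.comp !mxE -!expr2.
  move=> s t st; apply/rowP => i; rewrite !mxE !derG0 (Hh i).2.2// riE.
  by apply: eq_Rintegral => x _; rewrite mxE.
have symm (c : R) i (u t : R) : (forall j, c * Gamma j u 0 i = Gamma j t 0 i) ->
    c * X i u = X i t.
  move=> hc; apply: (cvg_eq_ultra UF _ (hX i t)).
  have -> : (fun j => Gamma j t 0 i) = (fun j => c * Gamma j u 0 i).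
    by apply/funext => j; rewrite hc.
  by apply: cvgM; [exact: cvg_cst|exact: hX].
exists Gamma0, phi; split; [exact: W0|split; [exact: alG0|split]]; last first.
  split; [exact: phi_inc|split] => i e e0.
    by have [N _ hN] := cvX i e e0; exists N => // k /hN hk t; rewrite mxE.
  by have [N _ hN] := cvY i e e0; exists N => // k /hN hk t; rewrite derG0; exact: hk.
split.
  by move=> t; apply: differentiable_continuous; exact/derivable1_diffP.
split=> //; split.
  rewrite /curve_length /I01.
  have -> : (fun t => enorm (derive1 Gamma0 t)) = (fun=> 1) by apply/funext.
  by rewrite -riE ri_cst// subr0 mulr1.
split; [|split] => t; apply/rowP => i; rewrite !mxE; apply: symm => j.
- have [_ [_ [_ [R1 _]]]] := hD j.
  by have := congr1 (fun v : V3 R => v 0 i) (R1 t); rewrite mxE.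
- have [_ [_ [_ [_ [R2 _]]]]] := hD j.
  by have := congr1 (fun v : V3 R => v 0 i) (R2 t); rewrite mxE.
- have [_ [_ [_ [_ [_ R3]]]]] := hD j.
  by have := congr1 (fun v : V3 R => v 0 i) (R3 t); rewrite mxE.
Qed.

End Limit.

(** * Weak convergence in W^{2,2} *)

Section Weak.
Context {R : realType}.

Lemma curvature_energyE (gamma : R -> V3 R) : curvature_energy gamma =
  ri 0 1 (fun x => d2 gamma x 0 (inord 0) ^+ 2) +
  ri 0 1 (fun x => d2 gamma x 0 (inord 1) ^+ 2) +
  ri 0 1 (fun x => d2 gamma x 0 (inord 2) ^+ 2).
Proof. exact: sum3E. Qed.

Lemma ip22E (u v : R -> V3 R) : W22 u -> W22 v -> ip22 u v =
  \sum_(i < 3) (ip (fun t => u t 0 i) (fun t => v t 0 i) +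
    ip (fun t => derive1 u t 0 i) (fun t => derive1 v t 0 i) +
    ip (fun t => d2 u t 0 i) (fun t => d2 v t 0 i)).
Proof.
move=> hu hv.
have a1 i : itg 0 1 (fun t => u t 0 i * v t 0 i).
  by apply: itg_cont => x; apply: cvgM; exact: W22_cont.
have a2 i : itg 0 1 (fun t => derive1 u t 0 i * derive1 v t 0 i).
  by apply: itg_cont => x; apply: cvgM; exact: W22_cont1.
have a3 i : itg 0 1 (fun t => d2 u t 0 i * d2 v t 0 i).
  by apply: (L2_mul _ _).2; exact: W22_L2.
rewrite sum3E /ip -!riD//; try (by repeat apply: itgD => //).
have shuffle (x1 x2 x3 y1 y2 y3 z1 z2 z3 : R) :
  (x1 + x2 + x3) + (y1 + y2 + y3) + (z1 + z2 + z3) =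
  (x1 + y1 + z1) + (x2 + y2 + z2) + (x3 + y3 + z3) by ring.
by rewrite /ip22 riE; apply: eq_Rintegral => x _; rewrite !dot3E; exact: shuffle.
Qed.

(** The terms in the curve and its derivative converge uniformly; only the second derivatives
    require [weak_cvg], one coordinate at a time. *)
Lemma weak_W22_of_C1 (G : nat -> R -> V3 R) (G0 : R -> V3 R) (M : R) :
  (forall k, W22 (G k)) -> W22 G0 ->
  (forall k i, ip (fun t => d2 (G k) t 0 i) (fun t => d2 (G k) t 0 i) <= M) ->
  (forall i (e : R), 0 < e -> \forall k \near \oo, forall t,
     `|G k t 0 i - G0 t 0 i| <= e) ->
  (forall i (e : R), 0 < e -> \forall k \near \oo, forall t,
     `|derive1 (G k) t 0 i - derive1 G0 t 0 i| <= e) ->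
  weak_W22_cvg G G0.
Proof.
move=> hG h0 hM c0 c1 phi hphi.
(* [weak_cvg] asks for one bound covering both the sequence and the limit. *)
pose M' i := Num.max M (ip (fun t => d2 G0 t 0 i) (fun t => d2 G0 t 0 i)).
pose F (u : R -> V3 R) i := ip (fun t => u t 0 i) (fun t => phi t 0 i) +
    ip (fun t => derive1 u t 0 i) (fun t => derive1 phi t 0 i) +
    ip (fun t => d2 u t 0 i) (fun t => d2 phi t 0 i).
have FE u : W22 u -> ip22 u phi = F u (inord 0) + F u (inord 1) + F u (inord 2).
  by move=> hu; rewrite (ip22E hu hphi) sum3E.
have key i : (fun k => F (G k) i) @ \oo --> F G0 i.
  apply: cvgD; [apply: cvgD|].
  - exact: (@ip_unif R (fun k t => G k t 0 i) _ _ (fun k => W22_cont (i := i) (hG k))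
      (W22_cont (i := i) h0) (W22_cont (i := i) hphi) (c0 i)).
  - exact: (@ip_unif R (fun k t => derive1 (G k) t 0 i) _ _
      (fun k => W22_cont1 (i := i) (hG k)) (W22_cont1 (i := i) h0)
      (W22_cont1 (i := i) hphi) (c1 i)).
  - apply: (@weak_cvg R (fun k t => derive1 (G k) t 0 i) (fun k t => d2 (G k) t 0 i)
      (fun t => derive1 G0 t 0 i) _ (fun t => derive1 phi t 0 i) _ (M' i)
      (fun k => W22_prim i (hG k)) (fun k => W22_L2 i (hG k)) _ (W22_prim i h0)
      (W22_L2 i h0) _ (W22_prim i hphi) (W22_L2 i hphi) (c1 i)).
    + by move=> k; rewrite le_max hM.
    + by rewrite le_max lexx orbT.
have -> : (fun k => ip22 (G k) phi) =
    (fun k => F (G k) (inord 0) + F (G k) (inord 1) + F (G k) (inord 2)).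
  by apply/funext => k; exact: (FE _ (hG k)).
by rewrite (FE _ h0); apply: cvgD; [apply: cvgD|]; exact: key.
Qed.

End Weak.

(** * Comparison with competitors and passage to the limit *)

Theorem theorem1p3 (R : realType) (q : R) (KK : set (set (V3 R)))
  (theta : nat -> R) (Gamma : nat -> R -> V3 R) :
  2 < q <= 4 ->
  tame KK ->
  (exists beta, CK KK beta /\ D2sym beta) ->
  (forall j, 0 < theta j) ->
  theta @ \oo --> 0 ->
  (forall j, CK KK (Gamma j) /\ arclength (Gamma j) /\ D2sym (Gamma j) /\
     (forall beta, CK KK beta -> D2sym beta ->
        (Etheta q (theta j) (Gamma j) <= Etheta q (theta j) beta)%E)) ->
  exists (Gamma0 : R -> V3 R) (phi : nat -> nat),
    W22 Gamma0 /\ arclength Gamma0 /\ D2sym Gamma0 /\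
    (forall k, (phi k < phi k.+1)%N) /\
    weak_W22_cvg (fun k => Gamma (phi k)) Gamma0 /\
    C1_cvg (fun k => Gamma (phi k)) Gamma0 /\
    (forall beta, CK KK beta -> D2sym beta -> (bending Gamma0 <= bending beta)%E).
Proof.
move=> hq _ _ th0 thc hG.
have hW j : W22 (Gamma j) by have [[]] := hG j.
have hal j : arclength (Gamma j) by have [_ []] := hG j.
have hD j : D2sym (Gamma j) by have [_ [_ []]] := hG j.
have TPfin beta : CK KK beta -> exists2 p : R, 0 <= p &
    poweR (TP q beta) (1 / (q - 2)) = p%:E.
  move=> [bW [_ [breg [binj _]]]].
  have fin : (poweR (TP q beta) (1 / (q - 2)) < +oo)%E by apply: poweR_lty; exact: TP_lty.
  exists (fine (poweR (TP q beta) (1 / (q - 2)))); first by rewrite fine_ge0// poweR_ge0.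
  by rewrite fineK// ge0_fin_numE// poweR_ge0.
(* Minimality against beta, after dropping the nonnegative tangent-point term of the minimizer. *)
have upper beta p j : CK KK beta -> D2sym beta ->
    poweR (TP q beta) (1 / (q - 2)) = p%:E ->
    ((curvature_energy (Gamma j))%:E <= bending beta + (theta j * p)%:E)%E.
  move=> bC bD bp; rewrite -bending_arclength//.
  apply: le_trans (bending_le_Etheta q (Gamma j) (th0 j)) _.
  have [_ [_ [_ /(_ beta bC bD)]]] := hG j.
  by rewrite {2}/Etheta bp -EFinM.
(* The first N values are covered by their sum, the later ones by 1. *)
have [Th hTh] : exists Th : R, forall j, theta j <= Th.
  have [N _ hN] := (cvgrPdist_le _ _).1 thc 1 ltr01.
  exists (1 + \sum_(i < N) theta i) => j; have [jN|Nj] := ltnP j N.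
    rewrite (bigD1 (Ordinal jN))//= addrCA lerDl addr_ge0// sumr_ge0// => k _.
    exact: ltW.
  apply: (@le_trans _ _ 1); last by rewrite lerDl sumr_ge0// => k _; exact: ltW.
  by have := hN j Nj; rewrite /= sub0r normrN ger0_norm// ltW.
have [p0 p00 hp0] := TPfin (Gamma 0%N) (hG 0%N).1.
pose M := curvature_energy (Gamma 0%N) + Th * p0.
have hM j : curvature_energy (Gamma j) <= M.
  have := upper _ p0 j (hG 0%N).1 (hD 0%N) hp0.
  rewrite bending_arclength// -EFinD lee_fin => h; apply: le_trans h _.
  by rewrite lerD2l ler_wpM2r.
have [Gamma0 [phi [W0 [al0 [D0 [inc [c0 c1]]]]]]] := compactness hW hal hD hM.
exists Gamma0, phi; split; [exact: W0|split; [exact: al0|split; [exact: D0|]]].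
split; [exact: inc|split; [|split]].
- have hMi k i : ip (fun t => d2 (Gamma (phi k)) t 0 i) (fun t => d2 (Gamma (phi k)) t 0 i)
      <= M.
    rewrite ip_sqr; apply: le_trans (hM (phi k)).
    rewrite /curvature_energy (bigD1 i)//= lerDl.
    by apply: sumr_ge0 => l _; apply: ri_ge0 => x _; exact: sqr_ge0.
  exact: (@weak_W22_of_C1 R (fun k => Gamma (phi k)) Gamma0 M (fun k => hW (phi k))
    W0 hMi c0 c1).
(* The quarter allows for the doubling in [enorm_le_max] and leaves the inequality strict. *)
- move=> eps eps0; have e4 : 0 < eps / 4 by rewrite divr_gt0.
  have H0 : \forall k \near \oo, forall i t, `|Gamma (phi k) t 0 i - Gamma0 t 0 i| <= eps / 4.
    by apply: filter_forall => i; exact: c0.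
  have H1 : \forall k \near \oo, forall i t,
      `|derive1 (Gamma (phi k)) t 0 i - derive1 Gamma0 t 0 i| <= eps / 4.
    by apply: filter_forall => i; exact: c1.
  have [N0 _ h0] := H0; have [N1 _ h1] := H1; exists (maxn N0 N1) => // k.
  rewrite /= geq_max => /andP[/h0 {}h0 /h1 {}h1] t; split.
  + apply: (@le_lt_trans _ _ (2 * (eps / 4))); last by lra.
    by apply: enorm_le_max; [exact: ltW|move=> i; rewrite !mxE].
  + apply: (@le_lt_trans _ _ (2 * (eps / 4))); last by lra.
    by apply: enorm_le_max; [exact: ltW|move=> i; rewrite !mxE].
- move=> beta bC bD; have [p p_ge0 hp] := TPfin beta bC.
  have [->|bfin] := eqVneq (bending beta) +oo%E; first exact: leey.
  have b0 : (0 <= bending beta)%E.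
    by apply: integral_ge0 => t _; rewrite lee_fin mulr_ge0 ?sqr_ge0 ?enorm_ge0.
  have bE : bending beta = (fine (bending beta))%:E.
    by rewrite fineK// ge0_fin_numE// lt_neqAle bfin leey.
  rewrite bending_arclength// bE lee_fin; set b := fine _.
  (* Budget: two errors e / 9 in each of three coordinates, one for the scale h and one for the
     index k, plus e / 3 for the tangent-point term. *)
  apply/ler_addgt0Pr => e e0; have e9 : 0 < e / 9 by rewrite divr_gt0.
  have liminf i : \forall n \near \oo, ri 0 1 (fun x => d2 Gamma0 x 0 i ^+ 2) - e / 9 <
      energy n.+1%:R^-1 (fun t => derive1 Gamma0 t 0 i).
    apply: (energy_liminf (W22_prim i W0)).
    rewrite -itgE; last exact: (W22_L2 i W0).2.2.2.
    by rewrite lte_fin ltrBlDr ltrDl.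
  have [n _ /(_ n (leqnn n)) hn] : \forall n \near \oo, forall i,
      ri 0 1 (fun x => d2 Gamma0 x 0 i ^+ 2) - e / 9 <
      energy n.+1%:R^-1 (fun t => derive1 Gamma0 t 0 i) by exact: filter_forall.
  move: hn; set h := n.+1%:R^-1 => hn /=.
  have h0 : 0 < h by rewrite invr_gt0.
  have h1 : h <= 1 by rewrite invf_le1// ler1n.
  have [N1 _ hN1] : \forall k \near \oo, forall i,
      energy h (fun t => derive1 Gamma0 t 0 i) <=
      energy h (fun t => derive1 (Gamma (phi k)) t 0 i) + e / 9.
    apply: filter_forall => i.
    exact: (@energy_lsc R (fun k t => derive1 (Gamma (phi k)) t 0 i)
      (fun t => derive1 Gamma0 t 0 i) h h0 (fun k => W22_cont1 (i := i) (hW (phi k)))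
      (W22_cont1 (i := i) W0) (c1 i) (e / 9) e9).
  have [N2 _ hN2] : \forall j \near \oo, theta j * p <= e / 3.
    have hc : (fun j => theta j * p) @ \oo --> 0 * p by apply: cvgM => //; exact: cvg_cst.
    have e3 : 0 < e / 3 by rewrite divr_gt0.
    move/cvgrPdist_le: hc => /(_ _ e3); apply: filterS => j.
    by rewrite mul0r sub0r normrN ger0_norm// mulr_ge0// ltW.
  have arith1 (x y z w f : R) : x - f < y -> y <= z + f -> z <= w -> x <= w + (f + f).
    by move=> ? ? ?; lra.
  have arith2 (x y z x' y' z' f : R) : x <= x' + (f + f) -> y <= y' + (f + f) ->
    z <= z' + (f + f) -> x + y + z <= x' + y' + z' + 6 * f by move=> ? ? ?; lra.
  have arith3 (x c u : R) : x <= u / 3 -> c <= b + x -> c + 6 * (u / 9) <= b + u.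
    by move: b => b' ? ?; lra.
  (* theta is evaluated at phi k, and phi k >= k carries the threshold N2 over to the
     subsequence. *)
  have phi_ge k : (k <= phi k)%N.
    by elim: k => [//|k IH]; exact: leq_ltn_trans IH (inc k).
  pose k := maxn N1 N2.
  have hk1 := hN1 k (leq_maxl _ _).
  have hk2 := hN2 (phi k) (leq_trans (leq_maxr _ _) (phi_ge k)).
  have hk3 := upper _ _ (phi k) bC bD hp; rewrite bE -EFinD lee_fin -/b in hk3.
  have step i : ri 0 1 (fun x => d2 Gamma0 x 0 i ^+ 2) <=
      ri 0 1 (fun x => d2 (Gamma (phi k)) x 0 i ^+ 2) + (e / 9 + e / 9).
    have l2 := W22_L2 i (hW (phi k)).
    have h01 : 0 < h <= 1 by rewrite h0 h1.
    exact: arith1 (hn i) (hk1 i) (energy_le (W22_prim i (hW (phi k))) l2.1 l2.2.2 h01).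
  apply: (@le_trans _ _ (curvature_energy (Gamma (phi k)) + 6 * (e / 9))).
    rewrite !curvature_energyE.
    exact: arith2 (step (inord 0)) (step (inord 1)) (step (inord 2)).
  exact: arith3 hk2 hk3.
Qed.
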